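(* Let $T>0$, $R_1,R_2\ge0$ and $L_1,L_2>0$ be reals. Assume that $i:[0,T]\to\mathbb R$ is an absolutely continuous function and that $C_k:[0,T]\to\mathbb R\setminus\{0\}$, $k=1,2,3$, are continuous functions. Put $$A_1=\begin{pmatrix}\frac{R_1+R_2}{L_1}&-\frac{R_2}{L_1}\\-\frac{R_2}{L_2}&\frac{R_1+R_2}{L_2}\end{pmatrix},\qquad A_2(t)=\begin{pmatrix}\frac{1}{L_1C_1(t)}+\frac{1}{L_1C_3(t)}&-\frac{1}{L_1C_3(t)}\\-\frac{1}{L_2C_3(t)}&\frac{1}{L_2C_2(t)}+\frac{1}{L_2C_3(t)}\end{pmatrix}.$$ Then for any initial condition $x(0)=x_0\in[i(0),+\infty)\times[0,+\infty)$, the problem $$-\dot x(t)\in N_{[i(t),+\infty)\times[0,+\infty)}(x(t))+A_1x(t)+\int_{0}^{t}\left[A_2(t)\,x(s)+\begin{pmatrix}\frac{1}{L_1C_1(t)}\,i(s)\\0\end{pmatrix}\right]ds\quad\text{a.e. } t\in[0,T],$$ has one and only one absolutely continuous solution $x(\cdot)=(x_1(\cdot),x_2(\cdot)):[0,T]\to\mathbb R^2$.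
   Context: For a closed convex set $S\subset\mathbb R^2$ and $x\in S$, $N_S(x)=\{v\in\mathbb R^2:\langle v,y-x\rangle\le0\ \forall y\in S\}$ is the normal cone, and $N_S(x)=\emptyset$ for $x\notin S$. The system models an electrical circuit with resistances $R_1,R_2$, inductances $L_1,L_2$, time-varying capacitances $C_1,C_2,C_3$, two ideal diodes and a current source $i$. *)

(* Defs.v *)
From HB Require Import structures.
From mathcomp Require Import all_boot all_order all_algebra.
From mathcomp Require Import all_classical all_reals all_analysis.

Set Implicit Arguments.
Unset Strict Implicit.
Unset Printing Implicit Defensive.
Import Order.TTheory GRing.Theory Num.Theory.
Import numFieldNormedType.Exports.

Local Open Scope classical_set_scope.
Local Open Scope ring_scope.

(* Vectors of R^n are columns 'cV[R]_n.  A function on [0, T] is represented by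
   a total function on R of which only the values on [0, T] matter. *)

Definition inner (R : realType) (n : nat) (u v : 'cV[R]_n) : R :=
  \sum_(k < n) u k 0 * v k 0.

(* The conjunct [S x] makes the cone empty when x is not in S. *)
Definition normal_cone (R : realType) (n : nat) (S : set 'cV[R]_n)
    (x : 'cV[R]_n) : set 'cV[R]_n :=
  [set v | S x /\ forall y, S y -> inner v (y - x) <= 0].

(* For column vectors `|_| is the sup norm; as all norms of R^n are equivalent,
   the notion is the same as with the Euclidean norm. *)
Definition abs_continuous (R : realType) (V : normedModType R) (a b : R)
    (f : R -> V) : Prop :=
  forall e : R, 0 < e -> exists2 d : R, 0 < d &
    forall (n : nat) (u v : 'I_n -> R),
      (forall k, a <= u k /\ u k <= v k /\ v k <= b) ->
      trivIset [set: 'I_n] (fun k => `]u k, v k[%classic) ->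
      \sum_(k < n) (v k - u k) < d ->
      \sum_(k < n) `|f (v k) - f (u k)| < e.

Definition col_integral (R : realType) (n : nat) (D : set R)
    (f : R -> 'cV[R]_n) : 'cV[R]_n :=
  \col_k (\int[lebesgue_measure]_(s in D) f s k 0).

Definition mx22 (R : realType) (a b c d : R) : 'M[R]_2 :=
  \matrix_(j, k) if j == 0 then (if k == 0 then a else b)
                 else (if k == 0 then c else d).

Definition col2 (R : realType) (a b : R) : 'cV[R]_2 :=
  \col_j if j == 0 then a else b.

Definition circuit_A1 (R : realType) (R1 R2 L1 L2 : R) : 'M[R]_2 :=
  mx22 ((R1 + R2) / L1) (- (R2 / L1))
       (- (R2 / L2))    ((R1 + R2) / L2).

Definition circuit_A2 (R : realType) (L1 L2 : R) (C1 C2 C3 : R -> R) (t : R) :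
    'M[R]_2 :=
  mx22 (1 / (L1 * C1 t) + 1 / (L1 * C3 t)) (- (1 / (L1 * C3 t)))
       (- (1 / (L2 * C3 t)))               (1 / (L2 * C2 t) + 1 / (L2 * C3 t)).

(* [a, +oo) x [0, +oo) *)
Definition quadrant (R : realType) (a : R) : set 'cV[R]_2 :=
  [set z | z 0 0 \in `[a, +oo[ /\ z 1 0 \in `[0, +oo[].

(* In the last conjunct, the image is the Minkowski sum of the normal cone and
   a vector. The two-sided derivative may depend on values outside [0, T] only
   at the end points, which form a null set. *)
Definition circuit_solution (R : realType) (T R1 R2 L1 L2 : R)
    (i C1 C2 C3 : R -> R) (x0 : 'cV[R]_2) (x : R -> 'cV[R]_2) : Prop :=
  [/\ abs_continuous 0 T x,
      x 0 = x0 &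
      {ae lebesgue_measure, forall t : R, t \in `[0, T] ->
        derivable x t 1 /\
        [set v + circuit_A1 R1 R2 L1 L2 *m x t
             + col_integral `[0, t]%classic (fun s =>
                 circuit_A2 L1 L2 C1 C2 C3 t *m x s
                 + col2 (1 / (L1 * C1 t) * i s) 0)
        | v in normal_cone (quadrant (i t)) (x t)] (- derive1 x t)}].

(* Main.v *)
(* The constraint set is a product of half-lines, so the normal cone splits and
   each coordinate is a one-dimensional reflection problem: x_k' = - F_k(x) in
   the interior, with an upward push on the obstacle.  Skorokhod's formula
   solves it: writing f_k for the free path x0_k - \int_0^t F_k(x), the
   reflected path is f_k + m_k with m_k(t) = sup_{s <= t} (l_k(s) - f_k(s))^+.
   The map f |-> f + m is 2-Lipschitz for the sup norm and F is a Volterra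
   operator, so the Picard operator contracts a norm weighted by exp(- rate t),
   which gives existence.  The running supremum m_k is nondecreasing and
   absolutely continuous, hence differentiable almost everywhere, and it is
   constant just before every time at which x_k is off the obstacle.
   For uniqueness, x_k - y_k can only be pushed down while it is positive, so
   a bound N on the weighted distance of two solutions improves to N / 2. *)
Require Import Defs.
From HB Require Import structures.
From mathcomp Require Import all_boot all_order all_algebra.
From mathcomp Require Import all_classical all_reals all_analysis.
From mathcomp Require Import ring lra.

Set Implicit Arguments.
Unset Strict Implicit.
Unset Printing Implicit Defensive.
Import Order.TTheory GRing.Theory Num.Theory.
Import numFieldNormedType.Exports.

Local Open Scope classical_set_scope.
Local Open Scope ring_scope.

(** Absolute continuity is exploited by two different routes. The upward push is nondecreasing, and
    its differentiability almost everywhere comes from measure theory: its Stieltjes measure is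
    dominated by Lebesgue measure, so the push is an indefinite integral of a Radon-Nikodym density.
    The difference of two solutions is not monotone; it is handled by a monotonicity principle
    instead, namely that an absolutely continuous function with nonpositive derivative almost
    everywhere does not increase. The weight works because integrating exp(rate t) divides it by
    [rate]. With Lipschitz constant K of the drift and rate = 4 K + 1, the free paths come within N
    / 4 and the running suprema within another N / 4, which is the factor 1 / 2 of the contraction.
    The matrix A_2(t) depends on the outer time only, so it leaves the integral: the drift is a
    combination of x and its primitive with continuous coefficients, and its Lipschitz constant can
    be chosen before the rate. *)

Section absolute_continuity.
Context {R : realType}.
Implicit Types (a b t : R) (f g h : R -> R).

(** The retraction of the line onto [a, b]. Composing with it turns data known on [a, b] only into
    functions on R, to which global notions of continuity and measure apply. *)
Definition clamp a b t : R := Num.max a (Num.min t b).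

Lemma clamp_in a b t : a <= b -> clamp a b t \in `[a, b].
Proof.
by move=> ab; rewrite in_itv/= /clamp le_max lexx/= ge_max ab ge_min lexx orbT.
Qed.

Lemma clamp_id a b t : t \in `[a, b] -> clamp a b t = t.
Proof. by rewrite in_itv/= => /andP[a_t tb]; rewrite /clamp (min_l tb) (max_r a_t). Qed.

Lemma le_clamp a b s t : s <= t -> clamp a b s <= clamp a b t.
Proof.
by move=> st; rewrite /clamp; case: (leP t b) => ?; case: (leP s b) => ?;
  case: (leP a t) => ?; case: (leP a s) => ?; case: (leP a b) => ?; lra.
Qed.

Lemma clampB_le a b s t : s <= t -> clamp a b t - clamp a b s <= t - s.
Proof.
by move=> st; rewrite /clamp; case: (leP t b) => ?; case: (leP s b) => ?;
  case: (leP a t) => ?; case: (leP a s) => ?; case: (leP a b) => ?; lra.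
Qed.

Lemma dist_clamp_le a b s t : `|clamp a b t - clamp a b s| <= `|t - s|.
Proof.
wlog st : s t / s <= t.
  move=> H; have /orP[|] := le_total s t; first exact: H.
  by move=> ts; rewrite distrC (distrC t); exact: H.
by rewrite !ger0_norm ?subr_ge0 ?le_clamp ?clampB_le.
Qed.

(** Ensures that a disjoint family of intervals stays disjoint when all endpoints are clamped. *)
Lemma clamp_itv_oo_sub a b u v : a <= b ->
  `]clamp a b u, clamp a b v[%classic `<=` `]u, v[%classic.
Proof.
move=> ab x; rewrite /= !in_itv/= /clamp gt_max lt_max gt_min lt_min.
by case/andP => /andP[ax /orP[ux|bx]] /orP[xa|/andP[xv xb]];
  rewrite ?ux ?xv//; lra.
Qed.

Lemma clamp_continuous a b : continuous (clamp a b).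
Proof.
move=> x; apply/cvgrPdist_lt => e e0; near=> t.
by apply: le_lt_trans (dist_clamp_le _ _ _ _) _; near: t; exact: cvgr_dist_lt.
Unshelve. end_near. Qed.

(* Shrinking [u, v] to [s, t] is what running suprema need; positive parts and
   truncations use it with [s, t] = [u, v]. *)
Lemma abs_continuous_le a b g h : abs_continuous a b (g : R -> R^o) ->
  (forall u v, a <= u -> u <= v -> v <= b ->
    exists s t, [/\ u <= s, s <= t, t <= v & `|h v - h u| <= `|g t - g s|]) ->
  abs_continuous a b (h : R -> R^o).
Proof.
move=> acg gh e e0; have [d d0 dP] := acg _ e0; exists d => // n u v uv tuv sd.
have /choice[s sP] : forall k, exists s : R * R,
    [/\ u k <= s.1, s.1 <= s.2, s.2 <= v k &
        `|h (v k) - h (u k)| <= `|g s.2 - g s.1|].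
  by move=> k; have [? [? ?]] := uv k; have [//|//|//|s [t ?]] := gh (u k) (v k);
    exists (s, t).
apply: le_lt_trans (dP n (fst \o s) (snd \o s) _ _ _).
- by apply: ler_sum => k _; have [] := sP k.
- by move=> k/=; have [? ? ? _] := sP k; have [? [? ?]] := uv k; split; lra.
- move=> i j _ _ [x [/= xi xj]]; apply: tuv => //; exists x; split => /=.
    by have [? ? ? _] := sP i; move: xi; rewrite !in_itv/= => /andP[? ?]; lra.
  by have [? ? ? _] := sP j; move: xj; rewrite !in_itv/= => /andP[? ?]; lra.
- apply: le_lt_trans sd; apply: ler_sum => k _ /=.
  by have [? ? ? _] := sP k; lra.
Qed.

Lemma abs_continuousD a b f g : abs_continuous a b (f : R -> R^o) ->
  abs_continuous a b (g : R -> R^o) ->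
  abs_continuous a b ((fun t => f t + g t) : R -> R^o).
Proof.
move=> acf acg e e0; have e20 : 0 < e / 2 by rewrite divr_gt0.
have [d d0 dP] := acf _ e20; have [d' d'0 d'P] := acg _ e20.
exists (Num.min d d') => [|n u v uv tuv]; first by rewrite lt_min d0.
rewrite lt_min => /andP[/(dP _ _ _ uv tuv) + /(d'P _ _ _ uv tuv)].
move=> H1 H2; rewrite [ltRHS]splitr; apply: le_lt_trans (ltrD H1 H2).
rewrite -big_split/=; apply: ler_sum => k _.
by apply: le_trans (ler_normD _ _); rewrite opprD addrACA.
Qed.

Lemma lipschitz_abs_continuous a b f (M : R) :
  (forall u v, a <= u -> u <= v -> v <= b -> `|f v - f u| <= M * (v - u)) ->
  abs_continuous a b (f : R -> R^o).
Proof.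
(* The constant M may be zero or negative; [|M| + 1] is a safe divisor. *)
move=> lf e e0; have M0 : 0 < `|M| + 1 by rewrite ltr_wpDl.
exists (e / (`|M| + 1)) => [|n u v uv tuv]; first by rewrite divr_gt0.
rewrite ltr_pdivlMr// => /(le_lt_trans _); apply; rewrite mulr_suml.
apply: ler_sum => k _; have [? [? ?]] := uv k.
apply: (le_trans (lf _ _ _ _ _)) => //; rewrite mulrC ler_wpM2l ?subr_ge0//.
by rewrite (le_trans (ler_norm _))// lerDl.
Qed.

Lemma abs_continuousN a b f : abs_continuous a b (f : R -> R^o) ->
  abs_continuous a b ((fun t => - f t) : R -> R^o).
Proof.
move=> /abs_continuous_le; apply => u v au uv vb; exists u, v; split => //.
by rewrite -opprD normrN.
Qed.

Lemma abs_continuousS a b c d f : a <= c -> d <= b ->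
  abs_continuous a b (f : R -> R^o) -> abs_continuous c d (f : R -> R^o).
Proof.
move=> ac db acf e /acf[r r0 rP]; exists r => // n u v uv.
by apply: rP => k; have [? [? ?]] := uv k; split; lra.
Qed.

(** Frees the intervals from lying in [a, b]: clamping shortens them and keeps them disjoint. Open
    sets of the whole line can then be tested. *)
Lemma abs_continuous_clamp a b f : a <= b ->
  abs_continuous a b (f : R -> R^o) ->
  forall e, 0 < e -> exists2 d, 0 < d & forall n (u v : 'I_n -> R),
    (forall k, u k <= v k) ->
    trivIset [set: 'I_n] (fun k => `]u k, v k[%classic) ->
    \sum_(k < n) (v k - u k) < d ->
    \sum_(k < n) `|f (clamp a b (v k)) - f (clamp a b (u k))| < e.
Proof.
move=> ab acf e /acf[d d0 dP]; exists d => // n u v uv tuv sd.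
apply: (dP n (clamp a b \o u) (clamp a b \o v)).
- move=> k /=; rewrite le_clamp//.
  have := clamp_in (u k) ab; have := clamp_in (v k) ab.
  by rewrite !in_itv/= => /andP[_ ?] /andP[].
- move=> i j _ _ [x [/= xi xj]]; apply: tuv => //.
  by exists x; split; exact: clamp_itv_oo_sub ab _ _.
- apply: le_lt_trans sd; apply: ler_sum => k _ /=; exact: clampB_le.
Qed.

(** Continuity is the case of families with a single interval. *)
Lemma abs_continuous_clamp_continuous a b f : a <= b ->
  abs_continuous a b (f : R -> R^o) -> continuous (f \o clamp a b).
Proof.
move=> ab /(abs_continuous_clamp ab) acf x; apply/cvgrPdist_lt => e /acf[d d0 dP].
have {}dP u v : u <= v -> v - u < d ->
    `|f (clamp a b v) - f (clamp a b u)| < e.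
  move=> uv vud; have := dP 1%N (fun=> u) (fun=> v).
  by rewrite !big_ord1; apply => // i j _ _; rewrite !ord1.
near=> t; have tx : `|x - t| < d by near: t; exact: cvgr_dist_lt.
have [xt|/ltW xt] := leP x t.
  rewrite distrC; apply: dP => //.
  by rewrite -(ger0_norm (x := t - x)) ?subr_ge0// distrC.
by apply: dP => //; rewrite -(ger0_norm (x := x - t)) ?subr_ge0.
Unshelve. all: by end_near. Qed.

End absolute_continuity.

(** * Open sets as disjoint intervals, and their Stieltjes measure *)

Section stieltjes.
Context {R : realType}.
Implicit Types (a b t : R) (f g h : R -> R).
Let mu : set R -> \bar R := @lebesgue_measure R.

Lemma open_interval_lty (I : set R) : open I -> is_interval I ->
  (mu I < +oo)%E -> exists uv : R * R, uv.1 <= uv.2 /\ I = `]uv.1, uv.2[%classic.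
Proof.
move=> oI /is_intervalP; move: (Rhull I) => i Ii.
have := oI; rewrite interior_id Ii => <-.
(* The empty set is represented by ]0, 0[; otherwise finite measure excludes the unbounded
   intervals. *)
have [->|/set0P[z iz]] := eqVneq [set` i] set0.
  by move=> _; exists (0, 0); rewrite interior0 set_itv_ge// bnd_simp ltxx.
case: i iz {Ii} => -[p u|[]] [q v|[]]// iz;
  rewrite /mu ?interior_itv ?lebesgue_measure_itv /= ?ltry ?ltNyr /= => //.
move=> _; exists (u, v); split => //=.
by move: iz; rewrite /= itv_boundlr => /andP[]; case: p; case: q;
  rewrite !bnd_simp => H1 H2; lra.
by move: iz; rewrite /= in_itv/= andbF.
Qed.

Lemma open_disjoint_bounded_itv (U : set R) : open U -> (mu U < +oo)%E ->
  exists u v : nat -> R, [/\ forall n, u n <= v n,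
    trivIset [set: nat] (fun n => `]u n, v n[%classic) &
    U = \bigcup_n `]u n, v n[%classic].
Proof.
move=> oU Uoo; pose I := open_disjoint_itv oU.
have IU n : I n `<=` U.
  by move=> x Ix; rewrite (open_disjoint_itv_bigcup oU); exists n.
have /choice[uv uvP] : forall n, exists uv : R * R,
    uv.1 <= uv.2 /\ I n = `]uv.1, uv.2[%classic.
  move=> n; apply: open_interval_lty.
  - exact: open_disjoint_itv_open.
  - exact: open_disjoint_itv_is_interval.
  - apply: le_lt_trans Uoo; apply: le_measure => //; rewrite inE.
      by apply: measurable_realfun.open_measurable; exact: open_disjoint_itv_open.
    exact: measurable_realfun.open_measurable.
have IE : I = (fun n => `](uv n).1, (uv n).2[%classic).
  by apply/funext => n; have [] := uvP n.
exists (fst \o uv), (snd \o uv); split.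
- by move=> n; have [] := uvP n.
- by rewrite -IE; exact: open_disjoint_itv_trivIset.
- by rewrite -IE; exact: open_disjoint_itv_bigcup.
Qed.

Lemma sum_disjoint_itv_le (U : set R) n (u v : 'I_n -> R) : open U ->
  (forall k, u k <= v k) -> (forall k, `]u k, v k[%classic `<=` U) ->
  trivIset [set: 'I_n] (fun k => `]u k, v k[%classic) ->
  ((\sum_(k < n) (v k - u k))%:E <= mu U)%E.
Proof.
move=> oU uv uvU tuv.
have mI : measurable (\big[setU/set0]_(k < n) `]u k, v k[%classic : set R).
  exact: bigsetU_measurable.
have -> : ((\sum_(k < n) (v k - u k))%:E =
           mu (\big[setU/set0]_(k < n) `]u k, v k[%classic))%E.
  rewrite -sumEFin /mu measure_semi_additive_ord//=.
  apply: eq_bigr => k _; rewrite lebesgue_measure_itv/=; case: ifPn => //.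
  by rewrite -leNgt lee_fin => vu; congr _%:E; have := uv k; lra.
apply: le_measure; rewrite ?inE//; first exact: measurable_realfun.open_measurable.
by elim/big_ind : _ => // A B AU BU x [/AU|/BU].
Qed.

Section cumulative_measure.
Variable F : cumulative R R.
Let nu : set R -> \bar R := lebesgue_stieltjes_measure F.

Lemma stieltjes_itv_oc u v : u <= v -> nu `]u, v]%classic = (F v - F u)%:E.
Proof.
move=> uv; rewrite /nu /lebesgue_stieltjes_measure /measure_extension.
by rewrite measurable_mu_extE/= ?wlength_itv_bnd//; exact: is_ocitv.
Qed.

(* Families of disjoint intervals are the finite parts of open sets, so the
   definition of absolute continuity bounds the measure of small open sets. *)
Lemma stieltjes_open_le (U : set R) (d e : R) : open U -> (mu U < d%:E)%E ->
  (forall n (u v : 'I_n -> R), (forall k, u k <= v k) ->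
    trivIset [set: 'I_n] (fun k => `]u k, v k[%classic) ->
    \sum_(k < n) (v k - u k) < d -> \sum_(k < n) (F (v k) - F (u k)) <= e) ->
  (nu U <= e%:E)%E.
Proof.
move=> oU Ud acF.
have Uoo : (mu U < +oo)%E by rewrite (lt_trans Ud)// ltry.
have [u [v [uv tuv UE]]] := open_disjoint_bounded_itv oU Uoo.
have -> : nu U = (\sum_(0 <= n <oo) nu `]u n, v n[%classic)%E.
  rewrite {1}UE; apply: measure_semi_bigcup => //.
  by rewrite -UE; exact: measurable_realfun.open_measurable.
apply: lime_le; first exact: is_cvg_nneseries.
apply: nearW => N; rewrite big_mkord.
have tuvN : trivIset [set: 'I_N] (fun k => `]u k, v k[%classic).
  by move=> i j _ _ ij; apply: val_inj; exact: tuv ij.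
apply: (@le_trans _ _ (\sum_(k < N) (F (v k) - F (u k))%:E)%E).
  apply: lee_sum => k _; rewrite -stieltjes_itv_oc//.
  apply: le_measure; rewrite ?inE//.
  by apply: subset_itvl; rewrite bnd_simp.
rewrite sumEFin lee_fin; apply: (acF N (u \o val) (v \o val)) => //=.
rewrite -lte_fin; apply: le_lt_trans Ud.
apply: sum_disjoint_itv_le => //= k x ux; rewrite UE; by exists k.
Qed.

End cumulative_measure.

End stieltjes.

(** * Differentiability of monotone absolutely continuous functions *)

Section derivability.
Context {R : realType}.
Implicit Types (a b t : R) (f g h : R -> R).

(** The Stieltjes measure of the clamped f, restricted to ]a, b], vanishes on Lebesgue null sets.
    Its density h satisfies f s - f a = integral of h up to s, and such an integral is
    differentiable almost everywhere by Lebesgue differentiation. *)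
Lemma abs_continuous_nondecreasing_derivable a b f : a < b ->
  abs_continuous a b (f : R -> R^o) ->
  (forall s t, a <= s -> s <= t -> t <= b -> f s <= f t) ->
  {ae @lebesgue_measure R, forall t, t \in `]a, b[ -> derivable f t 1}.
Proof.
move=> ab acf ndf; have leab := ltW ab.
pose F0 : R -> R := f \o clamp a b.
have ndF : {homo F0 : x y / x <= y}.
  move=> x y xy; apply: ndf; rewrite ?le_clamp//.
    by have := clamp_in x leab; rewrite in_itv/= => /andP[].
  by have := clamp_in y leab; rewrite in_itv/= => /andP[].
have cF : continuous F0 by exact: abs_continuous_clamp_continuous.
have rcF : right_continuous F0.
  by move=> x; apply: cvg_at_right_filter; exact: cF.
pose F : cumulative R R := HB.pack F0 (isCumulative.Build R _ R F0 ndF rcF).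
pose nu : {measure set (measurableTypeR R) -> \bar R} := lebesgue_stieltjes_measure F.
have nuE u v : u <= v -> nu `]u, v]%classic = (F0 v - F0 u)%:E.
  exact: (stieltjes_itv_oc F).
have mD : measurable (`]a, b]%classic : set (measurableTypeR R)) by exact: measurable_itv.
have nuD : nu `]a, b]%classic = (f b - f a)%:E.
  by rewrite nuE// /F/= /F0/= !clamp_id// in_itv/= lexx leab.
have nuDoo : (nu `]a, b]%classic < +oo)%E by rewrite nuD ltry.
pose nuab : {finite_measure set (measurableTypeR R) -> \bar R} := mfrestr mD nuDoo.
have dom : nuab `<< @lebesgue_measure R.
  (* A null set A sits in an open U of Lebesgue measure less than d, whose Stieltjes measure is at
     most e by absolute continuity; e is arbitrary. *)
  apply/null_content_dominatesP => A mA A0.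
  apply/eqP; rewrite eq_le measure_ge0 andbT; apply/lee_addgt0Pr => e e0.
  rewrite add0e; have [d d0 dP] := abs_continuous_clamp leab acf e0.
  have [|U [oU AU UAd]] := lebesgue_regularity_outer mA _ d0; first by rewrite A0 ltry.
  have Ud : (lebesgue_measure U < d%:E)%E.
    apply: le_lt_trans UAd.
    have mU := measurable_realfun.open_measurable oU.
    rewrite -[X in lebesgue_measure X](setDUK AU) measureU//=.
    - by rewrite A0 add0e.
    - exact: measurableD.
    - by rewrite setDIK.
  have : (nu U <= e%:E)%E.
    apply: (@stieltjes_open_le R F U d e oU Ud) => n u v uv tuv sd.
    apply: le_trans (ltW (dP n u v uv tuv sd)).
    by apply: ler_sum => k _; exact: ler_norm.
  apply: le_trans; rewrite /nuab/= /mfrestr/= /mrestr/=.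
  apply: le_measure; rewrite ?inE//.
  - exact: measurableI.
  - exact: measurable_realfun.open_measurable.
  - by move=> x [/AU].
have [g [g0 gfin gint gE]] := radon_nikodym_sigma_finite dom.
pose h := fine \o g.
have gh : g = EFin \o h by apply/funext => x; rewrite /h /= fineK.
have inth : (@lebesgue_measure R).-integrable setT (EFin \o h) by rewrite -gh.
have inth' y : (@lebesgue_measure R).-integrable `]-oo, y] (EFin \o h).
  by apply: integrableS inth => //; exact: measurable_itv.
have := FTC1Ny inth' (open_integrable_locally openT inth).
apply: filterS; first exact: (ae_filter_ringOfSetsType (@lebesgue_measure R)).
move=> t [dt _]; rewrite in_itv/= => /andP[a_t tb].
have prim_h s : s \in `]a, b[ -> \int[lebesgue_measure]_(t in `]-oo, s]) h t = f s - f a.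
  rewrite in_itv/= => /andP[a_s sb].
  have -> : \int[lebesgue_measure]_(t in `]-oo, s]) h t = fine (nuab `]-oo, s]%classic).
    by rewrite gE ?gh//; exact: measurable_itv.
  rewrite /nuab/= /mfrestr /mrestr.
  have -> : `]-oo, s] `&` `]a, b] = `]a, s]%classic :> set (measurableTypeR R).
    apply/seteqP; split => x /=; rewrite !in_itv/=.
      by move=> [xs /andP[-> _]].
    by move=> /andP[-> xs]; split => //; rewrite (le_trans xs)// ltW.
  rewrite nuE ?(ltW a_s)//= /F0/= !clamp_id// in_itv/= ?lexx//.
  by rewrite !ltW.
apply: (@near_eq_derivable R R^o R^o
  (fun s => \int[lebesgue_measure]_(t in `]-oo, s]) h t + f a) f t 1).
  near=> s; rewrite prim_h ?subrK//.
  by near: s; apply: near_in_itvoo; rewrite in_itv/= a_t.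
exact: derivableD.
Unshelve. all: by end_near. Qed.

End derivability.

(** * From the sign of the derivative to monotonicity *)

Section derive_le0.
Context {R : realType}.
Implicit Types (a b t : R) (f : R -> R).

Lemma derive1_quotient f t (e : R) : derivable f t 1 -> 0 < e ->
  exists2 d, 0 < d & forall h : R, h != 0 -> `|h| < d ->
    `|derive1 f t - (f (t + h) - f t) / h| < e.
Proof.
move=> df e0; have /cvgrPdist_lt/(_ _ e0)[d /= d0 dP] :
    h^-1 *: (f (h + t) - f t) @[h --> 0^'] --> derive1 f t.
  have := df; rewrite /derivable.
  have -> : (fun h : R => h^-1 *: ((f \o shift t) (h *: 1) - f t)) =
            (fun h : R => h^-1 *: (f (h + t) - f t)).
    by apply/funext => h; rewrite /= [h%:A]mulr1.
  exact.
exists d => // h h0 hd; rewrite [_ / _]mulrC (addrC t).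
by apply: dP; rewrite //= sub0r normrN.
Qed.

(** The interval [u, v] only has to contain t: the increment is split at t and each half is bounded
    by a difference quotient. This is the local form that continuous induction consumes. *)
Lemma derive1_le0_near f t (e : R) : 0 < e -> derivable f t 1 ->
  derive1 f t <= 0 -> exists2 d, 0 < d & forall u v, t - d < u -> u <= t ->
    t <= v -> v < t + d -> f v - f u <= e * (v - u).
Proof.
move=> e0 df f'0; have [d d0 dP] := derive1_quotient df e0.
have {}dP s : `|s - t| < d -> s != t -> (f s - f t) / (s - t) < e.
  move=> sd st; have := dP (s - t); rewrite subr_eq0 subrKC => /(_ st sd).
  by rewrite ltr_distlC => /andP[_]; lra.
exists d => // u v du ut tv vd.
have fv : f v - f t <= e * (v - t).
  have [->|tv'] := eqVneq v t; first lra.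
  have vt0 : 0 < v - t by rewrite subr_gt0 lt_neqAle eq_sym tv'.
  have := dP v; rewrite gtr0_norm// tv' ltr_pdivrMr// => H; apply/ltW/H => //; lra.
have fu : f t - f u <= e * (t - u).
  have [->|tu'] := eqVneq u t; first lra.
  have tu0 : u - t < 0 by rewrite subr_lt0 lt_neqAle tu'.
  have := dP u; rewrite ltr0_norm// tu' ltr_ndivrMr// => H.
  suff : e * (u - t) < f u - f t by lra.
  apply: H => //; lra.
lra.
Qed.

(** Left neighbours suffice, since the derivative exists and equals the left one. The running
    maximum is controlled only before t. *)
Lemma derive1_ge0_left f t (d : R) : 0 < d -> derivable f t 1 ->
  (forall s, t - d < s -> s <= t -> f s <= f t) -> 0 <= derive1 f t.
Proof.
move=> d0 df ft; rewrite leNgt; apply/negP => f'0.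
have nf'0 : 0 < - derive1 f t by rewrite oppr_gt0.
have [r r0 rP] := derive1_quotient df nf'0.
pose h := Num.min d r / 2.
have m0 : 0 < Num.min d r by rewrite lt_min d0.
have md : Num.min d r <= d by rewrite ge_min lexx.
have mr : Num.min d r <= r by rewrite ge_min lexx orbT.
have h0 : 0 < h by rewrite divr_gt0.
have := rP (- h); rewrite oppr_eq0 gt_eqF// normrN gtr0_norm//.
have -> : (f (t - h) - f t) / - h = (f t - f (t - h)) / h by field; rewrite gt_eqF.
have q0 : 0 <= (f t - f (t - h)) / h.
  have hd : t - d < t - h by rewrite /h; lra.
  have ht : t - h <= t by lra.
  by apply: divr_ge0 (ltW h0); rewrite subr_ge0; exact: ft.
have hr : h < r by rewrite /h; lra.
move=> /(_ isT hr); rewrite ltr_norml => /andP[H _]; lra.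
Qed.

Lemma derive1_eq0_left f t (d : R) : 0 < d -> derivable f t 1 ->
  (forall s, t - d < s -> s <= t -> f s = f t) -> derive1 f t = 0.
Proof.
move=> d0 df ft; apply/eqP; rewrite eq_le.
rewrite (derive1_ge0_left d0) ?andbT//; last by move=> s ds st; rewrite ft.
rewrite -oppr_ge0 -derive1N//; apply: (derive1_ge0_left d0).
  exact: derivableN.
by move=> s ds st; rewrite /= lerN2 ft.
Qed.

(** The invariant of the continuous induction. The exceptional intervals are carried along as one
    explicit disjoint family, so that absolute continuity bounds all of them at once when t reaches
    the right end. *)
Definition small_variation a (U : set R) (e : R) f t := exists n (u v : 'I_n -> R),
  [/\ forall k, a <= u k /\ u k <= v k /\ v k <= t,
      trivIset [set: 'I_n] (fun k => `]u k, v k[%classic),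
      forall k, `]u k, v k[%classic `<=` U &
      f t - f a <= e * (t - a) + \sum_(k < n) `|f (v k) - f (u k)|].

Lemma small_variation_step a (U : set R) (e : R) f s t : 0 <= e -> a <= s -> s <= t ->
  f t - f s <= e * (t - s) \/ `]s, t[%classic `<=` U ->
  small_variation a U e f s -> small_variation a U e f t.
Proof.
move=> e0 a_s st fst [n [u [v [uv tuv uvU fs]]]]; case: fst => [fst|stU].
  exists n, u, v; split => //; last lra.
  by move=> k; have [? [? ?]] := uv k; split => //; split => //; lra.
(* The new interval ]s, t[ gets index 0; it misses the old ones because they all end at s or
   earlier. *)
pose u' (k : 'I_n.+1) := if unlift ord0 k is Some j then u j else s.
pose v' (k : 'I_n.+1) := if unlift ord0 k is Some j then v j else t.
exists n.+1, u', v'; split.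
- move=> k; rewrite /u' /v'; case: unliftP => [j _|_] //.
  by have [? [? ?]] := uv j; split => //; split => //; lra.
- move=> i j _ _ [x []]; rewrite /u' /v' /= !in_itv/=.
  case: unliftP => [i' ->|->]; case: unliftP => [j' ->|->] // xi xj.
  + by congr lift; apply: tuv => //; exists x; rewrite /= !in_itv.
  + by have [? [? ?]] := uv i'; move/andP: xi => [? ?];
      move/andP: xj => [? ?]; exfalso; lra.
  + by have [? [? ?]] := uv j'; move/andP: xi => [? ?];
      move/andP: xj => [? ?]; exfalso; lra.
- by move=> k; rewrite /u' /v'; case: unliftP.
- rewrite big_ord_recl {1}/u' {1}/v' unlift_none.
  under eq_bigr do rewrite /u' /v' liftK.
  have := ler_norm (f t - f s).
  have : 0 <= e * (t - s) by rewrite mulr_ge0// subr_ge0.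
  lra.
Qed.

(* Continuous induction: away from the null set of bad points the increment is
   controlled by the derivative, on a small open neighbourhood of that set by
   absolute continuity. *)
Lemma abs_continuous_derive_le0 a b f : a <= b ->
  abs_continuous a b (f : R -> R^o) ->
  {ae @lebesgue_measure R, forall t, t \in `]a, b[ ->
    derivable f t 1 /\ derive1 f t <= 0} ->
  f b <= f a.
Proof.
move=> ab acf [N [mN N0 fN]].
suff H e : 0 < e -> f b - f a <= e * (b - a) + e.
  rewrite -subr_le0; apply/ler_addgt0Pr => e e0; rewrite add0r.
  have ba : 0 < b - a + 1 by lra.
  have := H (e / (b - a + 1)) (divr_gt0 e0 ba).
  by have <- : e = e / (b - a + 1) * (b - a) + e / (b - a + 1) by field; lra.
move=> e0; have [d d0 dP] := acf _ e0.
(* With the endpoints added, every point of [a, b] outside E is interior and has a nonpositive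
   derivative. *)
pose E := N `|` [set a; b].
have mE : measurable E by apply: measurableU => //; apply: measurableU.
have E0 : lebesgue_measure E = 0%E.
  by rewrite measureU0 ?measureU0//=; do ?[exact: measurableU | exact: lebesgue_measure_set1].
have Eoo : (lebesgue_measure E < +oo)%E by rewrite E0 ltry.
have [U [oU EU UEd]] := lebesgue_regularity_outer mE Eoo d0.
have Ud : (lebesgue_measure U < d%:E)%E.
  apply: le_lt_trans UEd.
  have mU := measurable_realfun.open_measurable oU.
  rewrite -[X in lebesgue_measure X](setDUK EU) measureU//=.
  - by rewrite E0 add0e.
  - exact: measurableD.
  - by rewrite setDIK.
suff [n [u [v [uv tuv uvU]]]] : small_variation a U e f b.
  move=> /le_trans; apply; rewrite lerD2l ltW//; apply: dP => //.
  rewrite -lte_fin; apply: le_lt_trans Ud.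
  by apply: sum_disjoint_itv_le => // k; have [? []] := uv k.
have loc s : a <= s -> s <= b -> exists2 r, 0 < r & forall u v, s - r < u -> u <= s ->
    s <= v -> v < s + r -> a <= u -> v <= b ->
    f v - f u <= e * (v - u) \/ `]u, v[%classic `<=` U.
  move=> a_s sb; have [Us|Us] := pselect (U s).
    have [r /= r0 rP] := open_subball oU Us.
    exists (r / 2) => [|u v ru us sv vr _ _]; first by rewrite divr_gt0.
    right => x /=; rewrite in_itv/= => /andP[ux xv].
    apply: (rP (r / 2)); rewrite ?divr_gt0//=.
      by rewrite sub0r normrN gtr0_norm ?divr_gt0// ; lra.
    by rewrite -ball_normE/= ltr_distl; apply/andP; split; lra.
  have nE : ~ E s by move/EU.
  have sab : s \in `]a, b[.
    rewrite in_itv/= !lt_neqAle a_s sb !andbT.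
    by apply/andP; split; apply/eqP => sE; apply: nE; right; [left|right].
  have [df f'0] : derivable f s 1 /\ derive1 f s <= 0.
    by apply: contrapT => H; apply: nE; left; apply: fN => /= /(_ sab).
  have [r r0 rP] := derive1_le0_near e0 df f'0.
  by exists r => // u v *; left; exact: rP.
pose S := [set t | [/\ a <= t, t <= b & small_variation a U e f t]].
have Sa : S a.
  split => //; exists 0%N, (fun=> a), (fun=> a); split => //.
  - by case.
  - by case.
  - by rewrite big_ord0 !subrr mulr0 addr0.
have ubS : ubound S b by move=> t [].
have hS : has_sup S by split; [exists a|exists b].
have a_s : a <= sup S by exact: ub_le_sup (proj2 hS) _ Sa.
have sb : sup S <= b by apply: ge_sup => //; exists a.
have [r r0 rP] := loc _ a_s sb.
have [u [a_u ub Su] ru] := sup_adherent r0 hS.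
have us : u <= sup S by apply: ub_le_sup (proj2 hS) _ _.
(* The point u of S is within r of the supremum, so one local step from u reaches v, which exceeds
   [sup S] unless the supremum is already b. *)
pose v := Num.min b (sup S + r / 2).
have sv : sup S <= v by rewrite le_min sb/=; lra.
have vr : v < sup S + r by rewrite gt_min; apply/orP; right; lra.
have vb : v <= b by rewrite ge_min lexx.
have Sv : S v.
  split => //; first lra.
  apply: small_variation_step Su => //; [exact: ltW|lra|exact: rP].
have vs : v <= sup S := ub_le_sup (proj2 hS) Sv.
suff <- : v = b by case: Sv.
by move: vs; rewrite /v; case: (leP b (sup S + r / 2)) => // _ ?; exfalso; lra.
Qed.

End derive_le0.

(** * Primitives and exponential weights *)

Section primitive.
Context {R : realType}.
Implicit Types (a b s t u v : R) (f g : R -> R).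

Definition primitive f t : R := \int[lebesgue_measure]_(s in `[0, t]) f s.

Lemma continuous_integrable_itv f a b : continuous f ->
  (@lebesgue_measure R).-integrable `[a, b] (EFin \o f).
Proof.
move=> cf; apply: continuous_compact_integrable; first exact: segment_compact.
exact: continuous_subspaceT.
Qed.

Lemma primitive0 f : primitive f 0 = 0.
Proof. by rewrite /primitive set_itv1 Rintegral_set1. Qed.

Lemma primitive_derive f t : continuous f -> 0 < t ->
  derivable (primitive f) t 1 /\ derive1 (primitive f) t = f t.
Proof.
move=> cf t0; apply: (@continuous_FTC1_closed _ f 0 t (t + 1)) => //.
  by rewrite ltrDl.
  exact: continuous_integrable_itv.
exact: cf.
Qed.

Lemma primitiveB f g t : continuous f -> continuous g ->
  primitive (fun s => f s - g s) t = primitive f t - primitive g t.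
Proof.
by move=> cf cg; rewrite /primitive RintegralB//; exact: continuous_integrable_itv.
Qed.

(** Both G minus the primitive and G plus the primitive have nonnegative derivative, hence are
    nondecreasing; G is any antiderivative of the bound g. *)
Lemma primitive_dist_le f (G : R -> R) (g : R -> R) u v : continuous f ->
  0 <= u -> u <= v -> (forall s, is_derive s 1 G (g s)) ->
  (forall s, u <= s -> s <= v -> `|f s| <= g s) ->
  `|primitive f v - primitive f u| <= G v - G u.
Proof.
move=> cf u0 uv dG fg.
have dp s : s \in `]u, v[ -> derivable (primitive f) s 1 /\ derive1 (primitive f) s = f s.
  by rewrite in_itv/= => /andP[us _]; apply: primitive_derive => //; exact: le_lt_trans us.
have cp : {within `[u, v], continuous primitive f}.
  apply: (@continuous_subspaceW _ _ _ `[0, v]).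
    by apply: subset_itvr; rewrite bnd_simp.
  apply: parameterized_integral_continuous; first exact: le_trans uv.
  exact: continuous_integrable_itv.
have cG : continuous G.
  by move=> s; apply/differentiable_continuous/derivable1_diffP; have [] := dG s.
have H (c : R) : `|c| = 1 -> G u - c * primitive f u <= G v - c * primitive f v.
  move=> c1; have dH s : s \in `]u, v[ ->
      is_derive s 1 (fun s => G s - c * primitive f s) (g s - c * f s).
    move=> /dp[d1 e1]; have := dG s => dGs.
    have dps : is_derive s 1 (primitive f) (f s) by split; rewrite -?derive1E.
    exact: is_derive_eq.
  apply: (@ger0_derive1_ndecr _ (fun s => G s - c * primitive f s) u v) => //.
  - by move=> s /dH[].
  - move=> s suv; rewrite derive1E; have [_ ->] := dH _ suv; rewrite subr_ge0.
    move: suv; rewrite in_itv/= => /andP[us sv].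
    apply: le_trans (fg _ (ltW us) (ltW sv)).
    by rewrite (le_trans (ler_norm _))// normrM c1 mul1r.
  - move=> s; apply: cvgB; first exact: (continuous_subspaceT cG).
    by apply: cvgM; [exact: cvg_cst|exact: cp].
have := H 1; rewrite normr1 => /(_ erefl).
have := H (- 1); rewrite normrN normr1 => /(_ erefl).
by rewrite ler_norml => ? ?; apply/andP; split; lra.
Qed.

Lemma is_derive_weight (lam t : R) :
  is_derive t 1 (fun s => expR (lam * s)) (lam * expR (lam * t)).
Proof.
have d1 : is_derive t 1 (fun s : R => lam * s) lam.
  by apply: is_derive_eq; rewrite [_ *: _]mulr1.
have := @is_derive1_comp _ expR (fun s => lam * s) t _ _ (is_derive_expR _) d1.
by rewrite mulrC.
Qed.

(** The gain of the factor 1 / lam is what makes the Picard operator contract. The antiderivative of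
    the weighted bound is used and its value at 0 is dropped. *)
Lemma primitive_weight_le f (lam N t : R) : continuous f -> 0 < lam -> 0 <= N ->
  0 <= t -> (forall s, 0 <= s -> s <= t -> `|f s| <= N * expR (lam * s)) ->
  `|primitive f t| <= N / lam * expR (lam * t).
Proof.
move=> cf lam0 N0 t0 fN.
pose G s := N / lam * expR (lam * s).
have dG s : is_derive s 1 G (N * expR (lam * s)).
  have := is_derive_weight lam s => dw.
  apply: is_derive_eq.
  by rewrite /GRing.scale/=; field; rewrite gt_eqF.
have := primitive_dist_le cf (lexx 0) t0 dG fN.
rewrite primitive0 subr0 => /le_trans; apply; rewrite lerBlDr lerDl.
by rewrite mulr_ge0 ?expR_ge0// divr_ge0// ltW.
Qed.

Lemma primitive_lipschitz f (M u v : R) : continuous f -> 0 <= u -> u <= v ->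
  (forall s, u <= s -> s <= v -> `|f s| <= M) ->
  `|primitive f v - primitive f u| <= M * (v - u).
Proof.
move=> cf u0 uv fM; rewrite mulrBr.
apply: (primitive_dist_le (G := fun s => M * s) cf u0 uv _ fM) => s.
by apply: is_derive_eq; rewrite [_ *: _]mulr1.
Qed.

Lemma continuous_bounded_itv f a b : continuous f ->
  exists2 M, 0 <= M & forall s, a <= s -> s <= b -> `|f s| <= M.
Proof.
move=> cf; have [ab|ba] := leP a b; last first.
  by exists 0 => // s ? ?; exfalso; lra.
have cnf : {within `[a, b], continuous (fun s => `|f s|)}.
  by apply: continuous_subspaceT => s; apply: cvg_norm; exact: cf.
have [c _ cP] := EVT_max ab cnf.
by exists `|f c| => // s s1 s2; apply: cP; rewrite in_itv/= s1.
Qed.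

Lemma abs_continuous_primitive f a b : continuous f -> 0 <= a ->
  abs_continuous a b (primitive f : R -> R^o).
Proof.
move=> cf a0; have [M _ fM] := continuous_bounded_itv a b cf.
apply: (@lipschitz_abs_continuous _ _ _ _ M) => u v au uv vb.
apply: primitive_lipschitz => //; first exact: le_trans au.
by move=> s us sv; apply: fM; [exact: le_trans us|exact: le_trans vb].
Qed.

End primitive.

(** * Running maxima of continuous functions *)

Section running_max.
Context {R : realType}.
Implicit Types (a b s t u v : R) (f g h : R -> R).

Definition running_max g t : R := sup [set g s | s in `[0, t]].

Section continuous_argument.
Variable g : R -> R.
Hypothesis cg : continuous g.

Lemma running_max_attained t : 0 <= t ->
  exists2 s, 0 <= s <= t & running_max g t = g s.
Proof.
move=> t0; have [c] := EVT_max t0 (continuous_subspaceT cg).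
rewrite in_itv/= => ct cP; exists c => //; apply/eqP; rewrite eq_le; apply/andP; split.
  by apply: ge_sup => [|_ [s /= st <-]]; [exists (g c), c|exact: cP].
by apply: ub_le_sup; [exists (g c) => _ [s /= st <-]; exact: cP|exists c].
Qed.

Lemma running_max_ge s t : 0 <= s <= t -> g s <= running_max g t.
Proof.
move=> /andP[s0 st]; have [c _ cP] := EVT_max (le_trans s0 st) (continuous_subspaceT cg).
apply: ub_le_sup; first by exists (g c) => _ [r /= rt <-]; exact: cP.
by exists s => //=; rewrite in_itv/= s0.
Qed.

Lemma running_max_le t (M : R) : 0 <= t ->
  (forall s, 0 <= s <= t -> g s <= M) -> running_max g t <= M.
Proof. by move=> t0 gM; have [s st ->] := running_max_attained t0; exact: gM. Qed.

Lemma le_running_max s t : 0 <= s -> s <= t -> running_max g s <= running_max g t.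
Proof.
move=> s0 st; apply: running_max_le => // r /andP[r0 rs].
by apply: running_max_ge; rewrite r0 (le_trans rs).
Qed.

(** If the maximum over [0, v] is attained at some s in [u, v], the growth from u to v is at most g
    s - g u; if it is attained before u, there is no growth. *)
Lemma abs_continuous_running_max b : abs_continuous 0 b (g : R -> R^o) ->
  abs_continuous 0 b (running_max g : R -> R^o).
Proof.
move=> /abs_continuous_le; apply => u v u0 uv vb.
have [s /andP[s0 sv] sE] := running_max_attained (le_trans u0 uv).
have muv := le_running_max u0 uv.
rewrite ger0_norm ?subr_ge0//; have [us|su] := leP u s.
  exists u, s; split => //; apply: le_trans (ler_norm _).
  by rewrite sE lerB// running_max_ge// u0 lexx.
exists u, u; split => //; rewrite subrr normr0 subr_le0 sE.
by apply: running_max_ge; rewrite s0 ltW.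
Qed.

(** By continuity g stays strictly below the maximum on a whole interval before t, so the maximum
    was attained before that interval. *)
Lemma running_max_locally_constant t : 0 < t -> g t < running_max g t ->
  exists2 d, 0 < d & forall s, t - d < s -> s <= t ->
    running_max g s = running_max g t.
Proof.
move=> t0 gt; have gt' : 0 < running_max g t - g t by rewrite subr_gt0.
have /cvgrPdist_lt/(_ _ gt')[d /= d0 dP] := @cg t.
(* The bound by t keeps s nonnegative. *)
exists (Num.min d t) => [|s ds st]; first by rewrite lt_min d0.
have md : Num.min d t <= d by rewrite ge_min lexx.
have mt : Num.min d t <= t by rewrite ge_min lexx orbT.
have s0 : 0 <= s by lra.
apply/eqP; rewrite eq_le le_running_max//=.
have [r /andP[r0 rt] rE] := running_max_attained (ltW t0).
rewrite rE; apply: running_max_ge; rewrite r0 leNgt; apply/negP => sr.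
have : g r < running_max g t.
  suff : `|g t - g r| < running_max g t - g t.
    by rewrite ltr_distlC => /andP[]; lra.
  by apply: dP; rewrite /= ltr_distlC; apply/andP; split; lra.
by rewrite rE ltxx.
Qed.

End continuous_argument.

Lemma running_max_dist_le g h t (D : R) : continuous g -> continuous h -> 0 <= t ->
  (forall s, 0 <= s <= t -> `|g s - h s| <= D) ->
  `|running_max g t - running_max h t| <= D.
Proof.
move=> cg ch t0 ghD; rewrite ler_distl; apply/andP; split.
  rewrite lerBlDr; apply: running_max_le => // s st.
  apply: (@le_trans _ _ (g s + D)); last by rewrite lerD2r running_max_ge.
  by have := ghD _ st; rewrite ler_distl => /andP[]; lra.
apply: running_max_le => // s st.
apply: (@le_trans _ _ (h s + D)); last by rewrite lerD2r running_max_ge.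
by have := ghD _ st; rewrite ler_distl => /andP[].
Qed.

End running_max.

(** * Comparison with an exponential *)

Section comparison.
Context {R : realType}.
Variables (T : R) (z : R -> R).
Hypotheses (T0 : 0 < T) (acz : abs_continuous 0 T (z : R -> R^o)).

Lemma last_nonpos t : z 0 <= 0 -> 0 <= t <= T -> exists2 s, 0 <= s <= t &
  z s <= 0 /\ forall r, s < r -> r <= t -> 0 < z r.
Proof.
move=> z00 /andP[t0 tT]; pose S := [set s | 0 <= s <= t /\ z s <= 0].
have S0 : S 0 by split; rewrite ?lexx.
have ubS : ubound S t by move=> s [/andP[]].
have hS : has_sup S by split; [exists 0|exists t].
have s0 : 0 <= sup S by exact: ub_le_sup (proj2 hS) _ S0.
have st : sup S <= t by apply: ge_sup => //; exists 0.
exists (sup S); first by rewrite s0.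
split; last first.
  move=> r sr rt; rewrite ltNge; apply/negP => zr.
  have : r <= sup S.
    by apply: ub_le_sup (proj2 hS) _ _; split=> //; rewrite rt andbT; lra.
  lra.
rewrite leNgt; apply/negP => zs.
have zE s : 0 <= s <= t -> z (clamp 0 T s) = z s.
  by move=> /andP[? ?]; rewrite clamp_id// in_itv/=; apply/andP; split; lra.
have cz := abs_continuous_clamp_continuous (ltW T0) acz.
have zs' : 0 < (z \o clamp 0 T) (sup S) by rewrite /= zE// s0.
have /cvgrPdist_lt/(_ _ zs')[d /= d0 dP] := cz (sup S).
have [s Ss ds] := sup_adherent d0 hS; have [sI zs0] := Ss.
have ss : s <= sup S by exact: ub_le_sup (proj2 hS) _ Ss.
have : 0 < (z \o clamp 0 T) s.
  suff : `|(z \o clamp 0 T) (sup S) - (z \o clamp 0 T) s| < (z \o clamp 0 T) (sup S).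
    by rewrite ltr_distlC => /andP[]; lra.
  by apply: dP; rewrite /= ltr_distlC; apply/andP; split; lra.
by rewrite /= zE// ltNge zs0.
Qed.

Lemma abs_continuous_weight (D lam a b : R) :
  abs_continuous a b ((fun t => D * expR (lam * t)) : R -> R^o).
Proof.
pose G (s : R) := D * expR (lam * s); pose dG (s : R) := D * (lam * expR (lam * s)).
have GdG (s : R) : is_derive s 1 G (dG s).
  by have := is_derive_weight lam s => dw; apply: is_derive_eq.
have cw : continuous (fun s : R => expR (lam * s)).
  by move=> s; apply: continuous_comp; [exact: mulrl_continuous|exact: continuous_expR].
have cdG : continuous dG.
  by move=> s; apply: cvgM; [exact: cvg_cst|apply: cvgM; [exact: cvg_cst|exact: cw]].
have [M _ MP] := continuous_bounded_itv a b cdG.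
apply: (@lipschitz_abs_continuous _ _ _ _ M) => u v au uv vb.
have cG : {within `[u, v], continuous G}.
  by apply: continuous_subspaceT => s; apply: cvgM; [exact: cvg_cst|exact: cw].
have [c] := MVT_segment uv (fun s _ => GdG s) cG.
rewrite in_itv/= => /andP[uc cv] ->.
rewrite normrM (ger0_norm (x := v - u)) ?subr_ge0// ler_wpM2r ?subr_ge0//.
by apply: MP; lra.
Qed.

(** The derivative is bounded only where z is positive. After the last time s at which z is
    nonpositive this bound holds up to t, so z minus the exponential does not increase on [s, t],
    and it starts nonpositive. *)
Lemma comparison (D lam : R) : 0 <= D -> z 0 <= 0 ->
  {ae @lebesgue_measure R, forall t, t \in `]0, T[ -> 0 < z t ->
    derivable z t 1 /\ derive1 z t <= D * (lam * expR (lam * t))} ->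
  forall t, 0 <= t <= T -> z t <= D * expR (lam * t).
Proof.
move=> D0 z00 dz t tT.
have [s /andP[s0 st] [zs zpos]] := last_nonpos z00 tT.
have /andP[t0 tT'] := tT.
pose h (r : R) := z r - D * expR (lam * r).
suff : h t <= h s.
  rewrite /h; have := mulr_ge0 D0 (expR_ge0 (lam * s)); lra.
apply: (abs_continuous_derive_le0 st).
  apply: abs_continuousD; last exact/abs_continuousN/abs_continuous_weight.
  exact: abs_continuousS acz.
apply: filterS dz; first exact: (ae_filter_ringOfSetsType (@lebesgue_measure R)).
move=> r dzr; rewrite in_itv/= => /andP[sr rt].
have [|d1 e1] := dzr _ (zpos _ sr (ltW rt)).
  by rewrite in_itv/=; apply/andP; split; lra.
have := is_derive_weight lam r => dw.
have dzr' : is_derive r 1 z (derive1 z r) by split; rewrite ?derive1E.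
have dh : is_derive r 1 h (derive1 z r - D * (lam * expR (lam * r))).
  exact: is_derive_eq.
by split; [case: dh|rewrite derive1E; case: dh => _ ->; lra].
Qed.

End comparison.

(** * Geometric sequences with explicit error bounds *)

Section geometric.
Context {R : realType}.

Lemma geometric_eq0 (z C : R) : (forall m, `|z| <= C / 2 ^+ m) -> z = 0.
Proof.
move=> zC; apply/eqP; rewrite -normr_eq0; apply: contrapT => /negP z0.
have {}z0 : 0 < `|z| by rewrite lt0r z0 normr_ge0.
have C0 : 0 <= C / `|z|.
  have := zC 0%N; rewrite expr0 divr1 => zC0.
  by rewrite divr_ge0// (le_trans _ zC0).
have := archi_boundP C0; set m := Num.bound _ => mP.
have := zC m; rewrite ler_pdivlMr ?exprn_gt0//.
move: mP; rewrite ltr_pdivrMr// => mP H.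
have : `|z| * 2 ^+ m < `|z| * m%:R by rewrite (le_lt_trans H)// mulrC.
rewrite ltr_pM2l// -natrX ltr_nat => H2.
by have := ltn_expl m (isT : (1 < 2)%N); rewrite ltnNge ltnW.
Qed.

(** Nested intervals: with d m = C / 2 ^ m, the lower ends u m - 2 d m increase and the upper ends u
    m + 2 d m decrease, because 2 d (m + 1) = d m. The limit is the supremum of the lower ends. *)
Lemma geometric_limit (u : nat -> R) (C : R) :
  (forall m, `|u m.+1 - u m| <= C / 2 ^+ m) ->
  exists L, forall m, `|u m - L| <= 2 * C / 2 ^+ m.
Proof.
move=> uC; have p0 m : 0 < 2 ^+ m :> R by rewrite exprn_gt0.
pose d m := C / 2 ^+ m; have dS m : d m.+1 = d m / 2.
  by rewrite /d exprS; field; rewrite lt0r_neq0.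
have d0 m : 0 <= d m by exact: (le_trans (normr_ge0 _) (uC m)).
have uCm m : u m - d m <= u m.+1 <= u m + d m.
  by have := uC m; rewrite ler_distl.
have lo : {homo (fun m => u m - 2 * d m) : m p / (m <= p)%N >-> m <= p}.
  apply: homo_leq => // [b a c ab bc|m]; first exact: le_trans bc.
  by rewrite dS; have := uCm m; lra.
have hi : {homo (fun m => u m + 2 * d m) : m p / (m <= p)%N >-> p <= m}.
  apply: (@homo_leq _ _ (fun x y => y <= x)) => // [b a c ab bc|m].
    exact: le_trans ab.
  by rewrite dS; have := uCm m; lra.
have lohi m p : u m - 2 * d m <= u p + 2 * d p.
  have := lo m (maxn m p) (leq_maxl _ _); have := hi p (maxn m p) (leq_maxr _ _).
  by have := d0 (maxn m p); lra.
pose S := range (fun m => u m - 2 * d m).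
have S0 : S !=set0 by exists (u 0%N - 2 * d 0%N), 0%N.
have ubS : has_ubound S by exists (u 0%N + 2 * d 0%N) => _ [m _ <-].
exists (sup S) => m; rewrite -mulrA -/(d m).
have H1 : u m - 2 * d m <= sup S by apply: ub_le_sup => //; exists m.
have H2 : sup S <= u m + 2 * d m by apply: ge_sup => // _ [p _ <-].
by rewrite ler_distl; apply/andP; split; lra.
Qed.

Lemma geometric_limit_continuous (x : nat -> R -> R) (y : R -> R) (C : R) :
  (forall m, continuous (x m)) -> (forall m t, `|x m t - y t| <= C / 2 ^+ m) ->
  continuous y.
Proof.
move=> cx xy t; apply/cvgrPdist_le => e e0.
have [m mP] : exists m, C / 2 ^+ m <= e / 3.
  apply: contrapT => /forallNP H.
  have : e / 3 = 0.
    apply: (@geometric_eq0 _ C) => m; rewrite ger0_norm; last lra.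
    by have /negP := H m; rewrite -ltNge => /ltW.
  by move=> ?; lra.
have e30 : 0 < e / 3 by rewrite divr_gt0.
have /cvgrPdist_le/(_ _ e30) := cx m t.
apply: filterS => s; have := xy m s; have := xy m t.
rewrite !ler_distl => /andP[? ?] /andP[? ?] /andP[? ?].
by apply/andP; split; lra.
Qed.

End geometric.

Lemma dist_max0_le (R : realDomainType) (a b : R) : `|Num.max 0 a - Num.max 0 b| <= `|a - b|.
Proof.
case: (leP 0 a) => ?; case: (leP 0 b) => ? //; rewrite ?subrr ?normr0//.
- by rewrite subr0 !ger0_norm; lra.
- by rewrite sub0r normrN ger0_norm// ler0_norm; lra.
Qed.

(** * The abstract reflection problem *)

Section reflection.
Context {R : realType} (n : nat) (T K : R) (l : 'I_n -> R -> R) (x0 : 'I_n -> R).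
Implicit Types x y : 'I_n -> R -> R.
Variable F : ('I_n -> R -> R) -> 'I_n -> R -> R.
Hypotheses (T0 : 0 < T) (K0 : 0 <= K).
Hypothesis cF : forall x, (forall k, continuous (x k)) -> forall k, continuous (F x k).
(* The exponential weight makes the Picard operator a contraction on all of
   [0, T] at once. *)
Hypothesis lipF : forall (lam N : R) x y t, 1 <= lam -> 0 <= N ->
  (forall k, continuous (x k)) -> (forall k, continuous (y k)) -> 0 <= t <= T ->
  (forall k s, 0 <= s <= t -> `|x k s - y k s| <= N * expR (lam * s)) ->
  forall k, `|F x k t - F y k t| <= K * N * expR (lam * t).
Hypothesis cl : forall k, continuous (l k).
Hypothesis acl : forall k, abs_continuous 0 T (l k : R -> R^o).
Hypothesis lx0 : forall k, l k 0 <= x0 k.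

(** The inclusion for a product of half-lines, written by coordinates: the velocity exceeds the free
    one by a nonnegative push, which is zero off the obstacle. Continuity is asked on all of R
    because the hypotheses on [F] speak of functions continuous on R. *)
Definition reflected_solution x := forall k,
  [/\ continuous (x k), abs_continuous 0 T (x k : R -> R^o), x k 0 = x0 k &
    {ae @lebesgue_measure R, forall t, t \in `]0, T[ ->
      [/\ derivable (x k) t 1, l k t <= x k t, - F x k t <= derive1 (x k) t &
          l k t < x k t -> derive1 (x k) t = - F x k t]}].

(** The factor 4 gives K / rate <= 1 / 4; the summand 1 gives rate >= 1, which [lipF] demands, even
    when K = 0. *)
Definition rate : R := 4 * K + 1.

Let rate_ge1 : 1 <= rate.
Proof. by rewrite /rate lerDr mulr_ge0. Qed.

Let rate_gt0 : 0 < rate.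
Proof. exact: lt_le_trans ltr01 rate_ge1. Qed.

Let K_rate N : 0 <= N -> K * N / rate <= N / 4.
Proof.
by move=> N0; rewrite ler_pdivrMr// /rate; nra.
Qed.

Lemma reflected_le x y (N : R) : 0 <= N -> reflected_solution x -> reflected_solution y ->
  (forall k s, 0 <= s <= T -> `|x k s - y k s| <= N * expR (rate * s)) ->
  forall k t, 0 <= t <= T -> y k t - x k t <= N / 2 * expR (rate * t).
Proof.
move=> N0 xS yS xyN k t tT.
have [cx acx xk0 dx] := xS k; have [cy acy yk0 dy] := yS k.
have D0 : 0 <= K * N / rate by rewrite divr_ge0 ?mulr_ge0// ltW.
apply: (@le_trans _ _ (K * N / rate * expR (rate * t))); last first.
  by rewrite ler_wpM2r ?expR_ge0// (le_trans (K_rate N0))//; lra.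
apply: (@comparison R T (fun t => y k t - x k t)) => //.
- by apply: abs_continuousD => //; exact: abs_continuousN.
- by rewrite xk0 yk0 subrr.
apply: filterS2 dx dy; first exact: (ae_filter_ringOfSetsType (@lebesgue_measure R)).
move=> s dx dy sT; have [d1 lx e1 _] := dx sT; have [d2 _ _ e2] := dy sT.
(* Where y is strictly above x it is off the obstacle and moves freely, while x can only be pushed
   up; hence the derivative of y - x is at most F x - F y. *)
rewrite subr_gt0 => xy; have {}e2 := e2 (le_lt_trans lx xy).
have dz : is_derive s 1 (fun t => y k t - x k t) (derive1 (y k) s - derive1 (x k) s).
  have d1' : is_derive s 1 (x k) (derive1 (x k) s) by split; rewrite ?derive1E.
  have d2' : is_derive s 1 (y k) (derive1 (y k) s) by split; rewrite ?derive1E.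
  exact: is_derive_eq.
split; first by case: dz.
rewrite derive1E; case: dz => _ ->; rewrite e2.
have {}sT : 0 <= s <= T.
  by move: sT; rewrite in_itv/= => /andP[? ?]; apply/andP; split; lra.
have bnd j r : 0 <= r <= s -> `|x j r - y j r| <= N * expR (rate * r).
  move=> /andP[r0 rs]; apply: xyN; rewrite r0 (le_trans rs)//.
  by case/andP: sT.
have := @lipF rate N x y s rate_ge1 N0 (fun j => let: And4 c _ _ _ := xS j in c)
  (fun j => let: And4 c _ _ _ := yS j in c) sT bnd k.
rewrite ler_norml => /andP[_ H].
have -> : K * N / rate * (rate * expR (rate * s)) = K * N * expR (rate * s).
  by field; rewrite gt_eqF.
lra.
Qed.

(** Starts both iterations. The weight is at least 1 on [0, T], so an unweighted bound suffices, and
    summing over k makes one N serve all coordinates. *)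
Lemma weight_bound (z : 'I_n -> R -> R) : (forall k, continuous (z k)) ->
  exists2 N, 0 <= N & forall k s, 0 <= s <= T -> `|z k s| <= N * expR (rate * s).
Proof.
move=> cz; have /choice[M MP] : forall k, exists M, 0 <= M /\
    forall s, 0 <= s -> s <= T -> `|z k s| <= M.
  by move=> k; have [M M0 MP] := continuous_bounded_itv 0 T (cz k); exists M.
have M0 k : 0 <= M k by have [] := MP k.
exists (\sum_k M k) => [|k s /andP[s0 sT]]; first exact: sumr_ge0.
have [_ /(_ _ s0 sT) zM] := MP k.
have MS : M k <= \sum_k M k by rewrite (bigD1 k)//= lerDl sumr_ge0.
apply: (le_trans (le_trans zM MS)); rewrite ler_peMr ?sumr_ge0// -expR0.
by rewrite ler_expR mulr_ge0// ltW.
Qed.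

Lemma reflected_unique x y : reflected_solution x -> reflected_solution y ->
  forall k t, 0 <= t <= T -> y k t = x k t.
Proof.
move=> xS yS.
have cxy k : continuous (fun s => x k s - y k s).
  by move=> s; apply: cvgB; [have [c _ _ _] := xS k|have [c _ _ _] := yS k]; exact: c.
have [N N0 NP] := weight_bound cxy.
have step m : forall k s, 0 <= s <= T -> `|x k s - y k s| <= N / 2 ^+ m * expR (rate * s).
  elim: m => [|m IH] k s sT; first by rewrite expr0 divr1; exact: NP.
  have Nm : 0 <= N / 2 ^+ m by rewrite divr_ge0// exprn_ge0.
  have IH' j r : 0 <= r <= T -> `|y j r - x j r| <= N / 2 ^+ m * expR (rate * r).
    by rewrite distrC; exact: IH.
  have := reflected_le Nm xS yS IH k sT; have := reflected_le Nm yS xS IH' k sT.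
  have -> : N / 2 ^+ m.+1 = N / 2 ^+ m / 2.
    by rewrite exprS; field; rewrite lt0r_neq0// exprn_gt0.
  by move=> ? ?; rewrite ler_distl; apply/andP; split; lra.
move=> k t tT; apply/esym/eqP; rewrite -subr_eq0; apply/eqP.
apply: (@geometric_eq0 _ _ (N * expR (rate * t))) => m.
by rewrite mulrAC; exact: step.
Qed.

Definition free_path x k t := x0 k - primitive (F x k) (clamp 0 T t).
Definition obstacle_gap x k t := Num.max 0 (l k t - free_path x k t).

(* Skorokhod's formula for the reflection of [free_path] above the obstacle [l]. *)
Definition picard x k t := free_path x k t + running_max (obstacle_gap x k) (clamp 0 T t).

Section picard_operator.
Variable x : 'I_n -> R -> R.
Hypothesis cx : forall k, continuous (x k).

Let acf k : abs_continuous 0 T (free_path x k : R -> R^o).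
Proof.
have acp := abs_continuous_primitive T (@cF x cx k) (lexx 0).
apply: abs_continuous_le (abs_continuousN acp) _ => u v u0 uv vT.
exists u, v; split => //.
have uT : u \in `[0, T] by rewrite in_itv/=; apply/andP; split; lra.
have vT' : v \in `[0, T] by rewrite in_itv/=; apply/andP; split; lra.
by rewrite /free_path !clamp_id// opprD addrACA subrr add0r.
Qed.

Let f_clamp k : free_path x k = free_path x k \o clamp 0 T.
Proof.
by apply/funext => t; rewrite /free_path /= [in RHS]clamp_id//; exact/clamp_in/ltW.
Qed.

Let continuous_f k : continuous (free_path x k).
Proof. by rewrite f_clamp; apply: abs_continuous_clamp_continuous => //; exact: ltW. Qed.

Let acg k : abs_continuous 0 T (obstacle_gap x k : R -> R^o).
Proof.
apply: abs_continuous_le (abs_continuousD (@acl k) (abs_continuousN (acf k))) _.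
by move=> u v u0 uv vT; exists u, v; split => //; exact: dist_max0_le.
Qed.

Lemma continuous_obstacle_gap k : continuous (obstacle_gap x k).
Proof.
move=> t; apply/cvgrPdist_le => e e0.
have /cvgrPdist_le/(_ _ e0) : l k s - free_path x k s @[s --> t] --> l k t - free_path x k t.
  by apply: cvgB; [exact: cl|exact: continuous_f].
by apply: filterS => s; apply: le_trans; exact: dist_max0_le.
Qed.

Lemma picard_clamp k t : picard x k (clamp 0 T t) = picard x k t.
Proof.
rewrite /picard [in LHS]f_clamp [in RHS]f_clamp /= !(clamp_id (t := clamp _ _ _))//;
  exact/clamp_in/ltW.
Qed.

Lemma picard_abs_continuous k : abs_continuous 0 T (picard x k : R -> R^o).
Proof.
apply: abs_continuousD => //.
have := abs_continuous_running_max (@continuous_obstacle_gap k) (@acg k).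
move=> /abs_continuous_le; apply => u v u0 uv vT; exists u, v; split => //.
by rewrite !clamp_id// in_itv/=; apply/andP; split; lra.
Qed.

Lemma picard_continuous k : continuous (picard x k).
Proof.
have -> : picard x k = picard x k \o clamp 0 T.
  by apply/funext => t; rewrite /= picard_clamp.
apply: abs_continuous_clamp_continuous; first exact: ltW.
exact: picard_abs_continuous.
Qed.

Lemma picard0 k : picard x k 0 = x0 k.
Proof.
have c0 : clamp 0 T 0 = 0 by rewrite clamp_id// in_itv/= lexx ltW.
have f0 : free_path x k 0 = x0 k by rewrite /free_path c0 primitive0 subr0.
rewrite /picard c0 f0.
have [s /andP[s0 s0'] ->] :=
  running_max_attained (@continuous_obstacle_gap k) (lexx 0).
have -> : s = 0 by apply/eqP; rewrite eq_le s0'.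
by rewrite /obstacle_gap f0 max_l ?addr0// subr_le0.
Qed.

(** With m the running maximum of the gap, x' = m' - F x. Monotonicity of m gives m' >= 0, and m >=
    l - f gives x >= l. *)
Lemma fixed_point_reflected : (forall k, picard x k = x k) -> reflected_solution x.
Proof.
move=> px k; split.
- exact: cx.
- by rewrite -px; exact: picard_abs_continuous.
- by rewrite -px picard0.
pose m t := running_max (obstacle_gap x k) t.
have acm : abs_continuous 0 T (m : R -> R^o).
  exact: (abs_continuous_running_max (@continuous_obstacle_gap k) (@acg k)).
have ndm s t : 0 <= s -> s <= t -> t <= T -> m s <= m t.
  by move=> s0 st _; exact: (le_running_max (@continuous_obstacle_gap k) s0 st).
have := abs_continuous_nondecreasing_derivable T0 acm ndm.
apply: filterS; first exact: (ae_filter_ringOfSetsType (@lebesgue_measure R)).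
move=> t dm tT; have {}dm := dm tT; have := tT; rewrite in_itv/= => /andP[t0 tT'].
have [dp ep] := primitive_derive (@cF x cx k) t0.
have dm' : is_derive t 1 m (derive1 m t) by split; rewrite ?derive1E.
have dp' : is_derive t 1 (primitive (F x k)) (F x k t) by split; rewrite -?derive1E.
have xE s : 0 <= s <= T -> x k s = x0 k - primitive (F x k) s + m s.
  by move=> sT; rewrite -px /picard /free_path /m clamp_id.
have dx : is_derive t 1 (x k) (derive1 m t - F x k t).
  apply: (@near_eq_is_derive R R^o R^o (fun s => x0 k - primitive (F x k) s + m s)).
    near=> s; rewrite xE//.
    have : s \in `]0, T[ by near: s; exact: near_in_itvoo.
    by rewrite in_itv/= => /andP[/ltW -> /ltW ->].
  by apply: is_derive_eq; rewrite add0r mul1r addrC.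
have tT2 : 0 <= t <= T by rewrite (ltW t0) ltW.
have gm : obstacle_gap x k t <= m t.
  by apply: running_max_ge; [exact: continuous_obstacle_gap|rewrite (ltW t0) lexx].
have fE : free_path x k t = x0 k - primitive (F x k) t by rewrite /free_path clamp_id.
have m0 s : 0 <= s -> 0 <= m s.
  move=> s0; apply: (@le_trans _ _ (obstacle_gap x k s)).
    by rewrite /obstacle_gap le_max lexx.
  by apply: running_max_ge; [exact: continuous_obstacle_gap|rewrite s0 lexx].
have dm0 : 0 <= derive1 m t.
  by apply: (derive1_ge0_left t0) => // s s0 st; apply: ndm => //; [lra|exact: ltW].
split.
- by case: dx.
- by move: gm; rewrite xE// -fE /obstacle_gap ge_max => /andP[_]; lra.
- by rewrite derive1E; case: dx => _ ->; lra.
rewrite xE// -fE => lx; rewrite derive1E; case: dx => _ ->.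
suff -> : derive1 m t = 0 by rewrite sub0r.
(* Off the obstacle l - f < m, but the truncated gap is strictly below m only if m t > 0. Otherwise
   m, nonnegative and nondecreasing, vanishes on [0, t]. *)
have [mt|mt] := leP (m t) 0.
  apply: (derive1_eq0_left t0) => // s s0 st.
  have s0' : 0 <= s by lra.
  by have := m0 _ s0'; have := ndm _ _ s0' st (ltW tT'); lra.
have gmt : obstacle_gap x k t < m t by rewrite /obstacle_gap gt_max mt; lra.
have [d d0 dP] := running_max_locally_constant (@continuous_obstacle_gap k) t0 gmt.
exact: (derive1_eq0_left d0).
Unshelve. all: by end_near. Qed.

End picard_operator.

(** The running maximum sees all the past, so the free paths are compared at every s <= t with the
    weight taken at t, which is the largest. *)
Lemma picard_contraction x y (N : R) : 0 <= N ->
  (forall k, continuous (x k)) -> (forall k, continuous (y k)) ->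
  (forall k s, 0 <= s <= T -> `|x k s - y k s| <= N * expR (rate * s)) ->
  forall k t, 0 <= t <= T -> `|picard x k t - picard y k t| <= N / 2 * expR (rate * t).
Proof.
move=> N0 cx cy xyN k t tT; have /andP[t0 tT'] := tT.
have fxy s : 0 <= s <= t -> `|free_path x k s - free_path y k s| <= N / 4 * expR (rate * t).
  move=> /andP[s0 st]; have sT : 0 <= s <= T by rewrite s0 (le_trans st).
  rewrite /free_path clamp_id ?in_itv//= opprD addrACA subrr add0r -opprD normrN.
  rewrite -primitiveB; [|exact: cF..].
  apply: (@le_trans _ _ (K * N / rate * expR (rate * s))).
    apply: primitive_weight_le => //.
    - by move=> r; apply: cvgB; [exact: cF|exact: cF].
    - exact: mulr_ge0.
    - move=> r r0 rs; apply: lipF => //; first by rewrite r0 (le_trans rs)//; case/andP: sT.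
      move=> j q /andP[q0 qr]; apply: xyN; rewrite q0 (le_trans qr)// (le_trans rs)//.
      by case/andP: sT.
  apply: ler_pM; rewrite ?expR_ge0 ?K_rate//.
    by rewrite divr_ge0 ?mulr_ge0// ltW.
  by rewrite ler_expR ler_wpM2l// ltW.
have gxy s : 0 <= s <= t -> `|obstacle_gap x k s - obstacle_gap y k s| <= N / 4 * expR (rate * t).
  move=> st; apply: le_trans (dist_max0_le _ _) _.
  rewrite (_ : _ - _ = - (free_path x k s - free_path y k s)); last by ring.
  by rewrite normrN; exact: fxy.
rewrite /picard clamp_id ?in_itv//= [X in `|X|](_ : _ = (free_path x k t - free_path y k t) +
  (running_max (obstacle_gap x k) t - running_max (obstacle_gap y k) t)); last by ring.
apply: (le_trans (ler_normD _ _)).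
have := fxy t; rewrite t0 lexx => /(_ isT) H1.
have H2 := running_max_dist_le (continuous_obstacle_gap cx (k := k))
  (continuous_obstacle_gap cy (k := k)) t0 gxy.
lra.
Qed.

(** The iterates start from the constant path and are frozen outside [0, T], so their geometric
    convergence there is uniform on R and the limit is continuous and frozen too. *)
Lemma picard_fixed_point : exists x, (forall k, continuous (x k)) /\
  forall k, picard x k = x k.
Proof.
pose X m := iter m picard (fun k _ => x0 k).
have cX m k : continuous (X m k).
  elim: m k => [|m IH] k; first by move=> ?; exact: cvg_cst.
  exact: picard_continuous.
have [N N0 NP] : exists2 N, 0 <= N &
    forall k s, 0 <= s <= T -> `|X 1%N k s - X 0%N k s| <= N * expR (rate * s).
  by apply: weight_bound => k s; apply: cvgB; exact: cX.
have Nm m : 0 <= N / 2 ^+ m by rewrite divr_ge0// exprn_ge0.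
have half m : N / 2 ^+ m / 2 = N / 2 ^+ m.+1.
  by rewrite exprS; field; rewrite lt0r_neq0// exprn_gt0.
have step m k s : 0 <= s <= T ->
    `|X m.+1 k s - X m k s| <= N / 2 ^+ m * expR (rate * s).
  elim: m k s => [|m IH] k s sT; first by rewrite expr0 divr1; exact: NP.
  rewrite -half; exact: (picard_contraction (Nm m) (cX m.+1) (cX m) IH).
have XT m k t : X m k (clamp 0 T t) = X m k t.
  by case: m => [//|m]; apply: picard_clamp; exact: cX.
have cT t : 0 <= clamp 0 T t <= T by have := clamp_in t (ltW T0); rewrite in_itv.
have /choice[y yP] : forall kt : 'I_n * R, exists L, forall m,
    `|X m kt.1 (clamp 0 T kt.2) - L| <=
      2 * (N * expR (rate * clamp 0 T kt.2)) / 2 ^+ m.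
  move=> [k t]; apply: geometric_limit => m /=.
  by rewrite mulrAC; exact: step.
pose x k t := y (k, t).
have xP m k t : `|X m k t - x k t| <= 2 * (N * expR (rate * clamp 0 T t)) / 2 ^+ m.
  by have := yP (k, t) m; rewrite /= XT.
have cx k : continuous (x k).
  apply: (@geometric_limit_continuous _ (fun m => X m k) _
    (2 * (N * expR (rate * T)))) => // m t.
  apply: le_trans (xP m k t) _; rewrite ler_wpM2r ?invr_ge0 ?exprn_ge0//.
  rewrite ler_wpM2l// ler_wpM2l// ler_expR ler_wpM2l//; first exact: ltW.
  by case/andP: (cT t).
have px k t : 0 <= t <= T -> picard x k t = x k t.
  move=> tT; apply/eqP; rewrite -subr_eq0; apply/eqP.
  apply: (@geometric_eq0 _ _ (2 * (N * expR (rate * t)))) => m.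
  have xX j s : 0 <= s <= T -> `|x j s - X m j s| <= 2 * N / 2 ^+ m * expR (rate * s).
    move=> sT; rewrite distrC; apply: le_trans (xP m j s) _.
    by rewrite clamp_id ?in_itv//= le_eqVlt; apply/orP; left; apply/eqP; ring.
  have N2m : 0 <= 2 * N / 2 ^+ m by rewrite -mulrA mulr_ge0.
  have H1 := picard_contraction N2m cx (cX m) xX k tT.
  have := xP m.+1 k t; rewrite clamp_id ?in_itv//= => H2.
  (* Both differences are at most N exp(rate t) / 2 ^ m: the first by contraction of the error 2 N /
     2 ^ m, the second as the error at m + 1. *)
  have -> : picard x k t - x k t = (picard x k t - picard (X m) k t) + (X m.+1 k t - x k t).
    by rewrite /X iterS; ring.
  apply: (le_trans (ler_normD _ _)); apply: (le_trans (lerD H1 H2)).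
  rewrite le_eqVlt; apply/orP; left; apply/eqP; rewrite exprS; field.
  by rewrite lt0r_neq0// exprn_gt0.
exists x; split => // k; apply/funext => t.
have -> : x k t = x k (clamp 0 T t).
  apply/esym/eqP; rewrite -subr_eq0; apply/eqP.
  (* Both values lie within 2 N exp(rate (clamp 0 T t)) / 2 ^ m of the same value of the m-th
     iterate, whence the 4. *)
  apply: (@geometric_eq0 _ _ (4 * (N * expR (rate * clamp 0 T t)))) => m.
  have H1 := xP m k t; have := xP m k (clamp 0 T t).
  rewrite XT [clamp _ _ (clamp _ _ _)]clamp_id; last exact/clamp_in/ltW.
  rewrite (_ : 4 = 2 + 2 :> R); last by ring.
  rewrite mulrDl mulrDl => H2; move: H1 H2; rewrite !ler_distl => /andP[? ?] /andP[? ?].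
  by apply/andP; split; lra.
by rewrite -px// picard_clamp.
Qed.

Lemma reflected_exists : exists x, reflected_solution x.
Proof.
by have [x [cx px]] := picard_fixed_point; exists x; exact: fixed_point_reflected.
Qed.

End reflection.

Section clamp_within.
Context {R : realType}.

Lemma continuous_within_clamp (a b : R) (f : R -> R) : a <= b ->
  {within `[a, b], continuous f} -> continuous (f \o clamp a b).
Proof.
move=> ab /subspace_continuousP cf x P /(cf _ (clamp_in x ab)).
move=> H; change (nbhs x ((f \o clamp a b) @^-1` P)).
have := @clamp_continuous _ a b x _ H.
apply: (@filterS _ (nbhs x)) => t; apply.
exact: clamp_in.
Qed.

End clamp_within.

(** * Volterra drifts with continuous coefficients *)

Section volterra.
Context {R : realType} (n : nat) (T : R).
Implicit Types (x y : 'I_n -> R -> R).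
Variables (A : 'M[R]_n) (B : R -> 'M[R]_n) (b : R -> 'I_n -> R).

Definition volterra x k t : R :=
  \sum_j (A k j * x j t + B t k j * primitive (x j) (clamp 0 T t)) + b t k.

Hypothesis T0 : 0 <= T.
Hypothesis cB : forall k j, continuous (fun t => B t k j).
Hypothesis cb : forall k, continuous (b^~ k).

Lemma continuous_sum_fun (I : Type) (r : seq I) (f : I -> R -> R) :
  (forall j, continuous (f j)) -> continuous (fun t => \sum_(j <- r) f j t).
Proof.
move=> cf; elim: r => [|j r IH].
  rewrite (_ : (fun=> _) = cst 0); first by move=> t; exact: cvg_cst.
  by apply/funext => t; rewrite big_nil.
rewrite (_ : (fun=> _) = (fun t => f j t + \sum_(j <- r) f j t)).
  by move=> t; apply: cvgD; [exact: cf|exact: IH].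
by apply/funext => t; rewrite big_cons.
Qed.

Lemma continuous_volterra x : (forall k, continuous (x k)) ->
  forall k, continuous (volterra x k).
Proof.
move=> cx k; have cp j : continuous (primitive (x j) \o clamp 0 T).
  by apply: abs_continuous_clamp_continuous => //; exact: abs_continuous_primitive.
move=> t; apply: cvgD; last exact: cb.
apply: (@continuous_sum_fun _ (index_enum 'I_n) (fun j t =>
  A k j * x j t + B t k j * primitive (x j) (clamp 0 T t))) => j {}t.
apply: cvgD; apply: cvgM; [exact: cvg_cst|exact: cx|exact: cB|exact: cp].
Qed.

(** K must not depend on [lam], as the rate is later computed from K. Since lam >= 1, the primitive
    costs N / lam <= N, and K just sums bounds of the coefficients. *)
Lemma volterra_lipschitz : exists2 K, 0 <= K & forall (lam N : R) x y t,
  1 <= lam -> 0 <= N -> (forall k, continuous (x k)) ->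
  (forall k, continuous (y k)) -> 0 <= t <= T ->
  (forall k s, 0 <= s <= t -> `|x k s - y k s| <= N * expR (lam * s)) ->
  forall k, `|volterra x k t - volterra y k t| <= K * N * expR (lam * t).
Proof.
have /choice[M MP] : forall kj : 'I_n * 'I_n, exists M, 0 <= M /\
    forall t, 0 <= t -> t <= T -> `|A kj.1 kj.2| + `|B t kj.1 kj.2| <= M.
  move=> [k j]; have [M M0 MP] := continuous_bounded_itv 0 T (@cB k j).
  exists (`|A k j| + M); split => [|t t0 tT]; first by rewrite addr_ge0.
  by rewrite lerD2l MP.
have M0 kj : 0 <= M kj by have [] := MP kj.
exists (\sum_k \sum_j M (k, j)) => [|lam N x y t lam1 N0 cx cy /andP[t0 tT] xyN k].
  by apply: sumr_ge0 => k _; exact: sumr_ge0.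
have lam0 : 0 < lam by exact: lt_le_trans lam1.
rewrite /volterra opprD addrACA subrr addr0 -sumrB clamp_id ?in_itv/= ?t0//.
apply: (@le_trans _ _ (\sum_j M (k, j) * N * expR (lam * t))); last first.
  rewrite -!mulr_suml -2!mulrA ler_wpM2r ?mulr_ge0 ?expR_ge0//.
  by rewrite [leRHS](bigD1 k)//= lerDl; apply: sumr_ge0 => i _; exact: sumr_ge0.
apply: (le_trans (ler_norm_sum _ _ _)); apply: ler_sum => j _.
rewrite opprD addrACA -!mulrBr -primitiveB//.
have xy : `|x j t - y j t| <= N * expR (lam * t) by apply: xyN; rewrite t0 lexx.
have pxy : `|primitive (fun s => x j s - y j s) t| <= N * expR (lam * t).
  apply: (@le_trans _ _ (N / lam * expR (lam * t))).
    apply: primitive_weight_le => //.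
      by move=> s; apply: cvgB; [exact: cx|exact: cy].
    by move=> s s0 st; apply: xyN; rewrite s0.
  by rewrite ler_wpM2r ?expR_ge0// ler_pdivrMr// ler_peMr.
apply: (le_trans (ler_normD _ _)); rewrite !normrM -mulrA.
apply: (@le_trans _ _ ((`|A k j| + `|B t k j|) * (N * expR (lam * t)))).
  by rewrite mulrDl lerD// ler_wpM2l.
by rewrite ler_wpM2r ?mulr_ge0 ?expR_ge0//; have [_] := MP (k, j); exact.
Qed.

End volterra.

(** * Passing between columns and their coordinates *)

Section columns.
Context {R : realType} (n : nat).
Implicit Types (v : 'cV[R]_n) (f : R -> 'cV[R]_n) (a b t : R).

Lemma col_norm_le v (e : R) : 0 <= e -> (`|v| <= e) <-> (forall k, `|v k 0| <= e).
Proof.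
move=> e0; rewrite [`|v|]mx_normrE; split.
  by move=> /bigmax_leP[_ H] k; exact: (H (k, 0)).
by move=> H; apply/bigmax_leP; split => // -[k j] _; rewrite ord1.
Qed.

Lemma cvg_col (F : set_system R) (FF : Filter F) f v :
  f s @[s --> F] --> v <-> forall k, f s k 0 @[s --> F] --> v k 0.
Proof.
split=> [fv k|fv].
  exact: (cvg_comp _ _ fv (@coord_continuous R n 1 k 0 v)).
apply/cvgrPdist_le => e e0.
suff : \forall s \near F, forall k, `|v k 0 - f s k 0| <= e.
  apply: filterS => s H; apply/(col_norm_le _ (ltW e0)) => k.
  by rewrite !mxE.
apply: filter_forall => k.
by have /cvgrPdist_le/(_ _ e0) := fv k.
Qed.

Lemma is_derive_col f (t : R) v :
  is_derive t 1 f v <-> forall k, is_derive t 1 (fun s => f s k 0) (v k 0).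
Proof.
have E k (h : R) : (h^-1 *: ((f \o shift t) (h *: 1) - f t)) k 0 =
    h^-1 *: (((fun s => f s k 0) \o shift t) (h *: 1) - f t k 0).
  by rewrite !mxE.
split=> [[df fv] k|dfv].
  have /cvg_col fc : h^-1 *: ((f \o shift t) (h *: 1) - f t) @[h --> 0^'] --> v.
    by rewrite -fv; exact: df.
  have {}fc : h^-1 *: (((fun s => f s k 0) \o shift t) (h *: 1) - f t k 0) @[h --> 0^']
      --> v k 0.
    by have := fc k; under eq_fun do rewrite E.
  split; first by apply/cvg_ex; exists (v k 0).
  exact: cvg_lim fc.
have fc : h^-1 *: ((f \o shift t) (h *: 1) - f t) @[h --> 0^'] --> v.
  apply/cvg_col => k; under eq_fun do rewrite E.
  by have [d <-] := dfv k; exact: d.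
split; first by apply/cvg_ex; exists v.
exact: cvg_lim fc.
Qed.

Lemma abs_continuous_coord a b f k : abs_continuous a b f ->
  abs_continuous a b ((fun s => f s k 0) : R -> R^o).
Proof.
move=> acf e /acf[d d0 dP]; exists d => // m u v uv tuv sd.
apply: le_lt_trans (dP m u v uv tuv sd); apply: ler_sum => j _.
have := (col_norm_le (f (v j) - f (u j)) (normr_ge0 _)).1 (lexx _) k.
by rewrite !mxE.
Qed.

Lemma ae_neq (a : R) : {ae @lebesgue_measure R, forall t, t <> a}.
Proof.
exists [set a]; split; [exact: measurable_set1|exact: lebesgue_measure_set1|].
by move=> t /= /contrapT.
Qed.

End columns.

Lemma ord2P (k : 'I_2) : k = 0 \/ k = 1.
Proof. by case: k => -[|[|//]] ?; [left|right]; exact: val_inj. Qed.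

Lemma abs_continuous_col2 (R : realType) (a b : R) (f : R -> 'cV[R]_2) :
  (forall k, abs_continuous a b ((fun s => f s k 0) : R -> R^o)) ->
  abs_continuous a b f.
Proof.
move=> acf e e0; have e20 : 0 < e / 2 by rewrite divr_gt0.
have [d d0 dP] := acf 0 _ e20; have [d' d'0 d'P] := acf 1 _ e20.
exists (Num.min d d') => [|m u v uv tuv]; first by rewrite lt_min d0.
rewrite lt_min => /andP[/(dP _ _ _ uv tuv) + /(d'P _ _ _ uv tuv)].
move=> H1 H2; rewrite [ltRHS]splitr; apply: le_lt_trans (ltrD H1 H2).
rewrite -big_split/=; apply: ler_sum => j _.
apply/col_norm_le => [|k]; first by rewrite addr_ge0.
by rewrite !mxE; case: (ord2P k) => ->; rewrite ?lerDl ?lerDr.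
Qed.

(** * The normal cone of the quadrant *)

Section quadrant_cone.
Context {R : realType} (a : R).
Implicit Types (z v : 'cV[R]_2).

Definition corner : 'I_2 -> R := fun k => if k == 0 then a else 0.

Lemma quadrantP z : quadrant a z <-> forall k, corner k <= z k 0.
Proof.
rewrite /quadrant /= !in_itv/= !andbT; split => [[z0 z1] k|H].
  by case: (ord2P k) => ->.
by split; [exact: (H 0)|exact: (H 1)].
Qed.

(** The cone is tested by moving one coordinate at a time: a unit move up forces v k <= 0, and a
    move down to the boundary, possible when z k is off it, forces v k >= 0. *)
Lemma normal_cone_quadrantP z v : normal_cone (quadrant a) z v <->
  forall k, [/\ corner k <= z k 0, v k 0 <= 0 & corner k < z k 0 -> v k 0 = 0].
Proof.
split=> [[/quadrantP zq vN] k|H].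
  have move_coord c : corner k <= z k 0 + c -> v k 0 * c <= 0.
    move=> kc; have := vN (z + c *: delta_mx k 0).
    have -> : inner v (z + c *: delta_mx k 0 - z) = v k 0 * c.
      rewrite /inner addrAC subrr add0r (bigD1 k)//= !mxE !eqxx mulr1 big1 ?addr0//.
      by move=> j jk; rewrite !mxE (negbTE jk) /= mulr0 mulr0.
    apply; apply/quadrantP => j; rewrite !mxE.
    by have [->|jk] := eqVneq j k; rewrite /= ?mulr1// mulr0 addr0.
  split=> [||kz]; first exact: zq.
    by rewrite -[leLHS]mulr1; apply: move_coord; rewrite (le_trans (zq k))// lerDl.
  apply/eqP; rewrite eq_le; apply/andP; split.
    by rewrite -[leLHS]mulr1; apply: move_coord; rewrite (le_trans (zq k))// lerDl.
  have := move_coord (corner k - z k 0); rewrite subrKC lexx => /(_ isT).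
  by rewrite nmulr_lle0// subr_lt0.
split; first by apply/quadrantP => k; have [] := H k.
move=> y /quadrantP yq; apply: sumr_le0 => k _; rewrite !mxE.
have [_ v0 vz] := H k; have [kz|zk] := ltP (corner k) (z k 0).
  by rewrite vz// mul0r.
by apply: mulr_le0_ge0 => //; rewrite subr_ge0 (le_trans zk).
Qed.

End quadrant_cone.

Section primitive_linear.
Context {R : realType}.

Lemma primitiveD (f g : R -> R) t : continuous f -> continuous g ->
  primitive (fun s => f s + g s) t = primitive f t + primitive g t.
Proof.
by move=> cf cg; rewrite /primitive RintegralD//; exact: continuous_integrable_itv.
Qed.

Lemma primitiveZ (c : R) (f : R -> R) t : continuous f ->
  primitive (fun s => c * f s) t = c * primitive f t.
Proof.
by move=> cf; rewrite /primitive RintegralZl//; exact: continuous_integrable_itv.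
Qed.

Lemma continuousZ_fun (c : R) (f : R -> R) : continuous f -> continuous (fun s => c * f s).
Proof. by move=> cf t; apply: cvgM; [exact: cvg_cst|exact: cf]. Qed.

Lemma primitive_sum (I : Type) (r : seq I) (c : I -> R) (f : I -> R -> R) t :
  (forall j, continuous (f j)) ->
  primitive (fun s => \sum_(j <- r) c j * f j s) t =
  \sum_(j <- r) c j * primitive (f j) t.
Proof.
move=> cf; elim: r => [|j r IH].
  rewrite big_nil (_ : (fun=> _) = fun=> 0); last by apply/funext => s; rewrite big_nil.
  by rewrite /primitive Rintegral_cst// mul0r.
rewrite big_cons -IH -primitiveZ// -primitiveD.
- by congr primitive; apply/funext => s; rewrite big_cons.
- exact: continuousZ_fun.
- by apply: continuous_sum_fun => k; exact: continuousZ_fun.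
Qed.

End primitive_linear.

(** * The circuit as a reflection problem *)

Section circuit.
Context {R : realType} (T R1 R2 L1 L2 : R) (i C1 C2 C3 : R -> R).
Hypotheses (hT : 0 < T) (hL1 : 0 < L1) (hL2 : 0 < L2).
Hypothesis hi : abs_continuous 0 T (i : R -> R^o).
Hypotheses (hC1 : {within `[0, T], continuous C1})
  (hC2 : {within `[0, T], continuous C2}) (hC3 : {within `[0, T], continuous C3}).
Hypotheses (nzC1 : forall t, t \in `[0, T] -> C1 t != 0)
  (nzC2 : forall t, t \in `[0, T] -> C2 t != 0)
  (nzC3 : forall t, t \in `[0, T] -> C3 t != 0).
Variable x0 : 'cV[R]_2.
Hypothesis hx0 : quadrant (i 0) x0.

Let c := clamp 0 T.
Let A1 := circuit_A1 R1 R2 L1 L2.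
Let A2 := circuit_A2 L1 L2 C1 C2 C3.

(* All data are extended to R by freezing them outside [0, T]; continuity is
   then continuity on R and derivatives at interior points are unchanged. *)
Definition source t k : R :=
  if k == 0 :> 'I_2 then 1 / (L1 * C1 (c t)) * primitive (i \o c) (c t) else 0.

Definition drift := volterra T A1 (A2 \o c) source.

Definition obstacle (k : 'I_2) t : R := corner (i (c t)) k.

Lemma continuous_inv (L : R) (C : R -> R) : 0 < L ->
  {within `[0, T], continuous C} -> (forall t, t \in `[0, T] -> C t != 0) ->
  continuous (fun t => 1 / (L * C (c t))).
Proof.
move=> L0 cC nzC t; have cCc := continuous_within_clamp (ltW hT) cC.
apply: cvgM; first exact: cvg_cst.
apply: cvgV; first by apply: mulf_neq0; [rewrite gt_eqF|exact/nzC/clamp_in/ltW].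
by apply: cvgM; [exact: cvg_cst|exact: cCc].
Qed.

Let continuous_i : continuous (i \o c).
Proof. by apply: abs_continuous_clamp_continuous => //; exact: ltW. Qed.

Lemma continuous_A2 k j : continuous (fun t => (A2 \o c) t k j).
Proof.
have I1 := continuous_inv hL1 hC1 nzC1; have I3 := continuous_inv hL1 hC3 nzC3.
have J2 := continuous_inv hL2 hC2 nzC2; have J3 := continuous_inv hL2 hC3 nzC3.
case: (ord2P k) => ->; case: (ord2P j) => ->; move=> t;
  rewrite /A2 /circuit_A2 /mx22 /=; under eq_fun do rewrite mxE/=; rewrite ?mxE/=.
- by apply: cvgD; [exact: I1|exact: I3].
- by apply: cvgN; exact: I3.
- by apply: cvgN; exact: J3.
- by apply: cvgD; [exact: J2|exact: J3].
Qed.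

Lemma continuous_source k : continuous (source^~ k).
Proof.
rewrite /source; case: (k == 0); last by move=> t; exact: cvg_cst.
move=> t; apply: cvgM; first exact: (continuous_inv hL1 hC1 nzC1).
have acp := abs_continuous_primitive T continuous_i (lexx 0).
exact: (abs_continuous_clamp_continuous (ltW hT) acp).
Qed.

Lemma continuous_obstacle k : continuous (obstacle k).
Proof.
rewrite /obstacle /corner; case: (k == 0); last by move=> t; exact: cvg_cst.
exact: continuous_i.
Qed.

Lemma abs_continuous_obstacle k : abs_continuous 0 T (obstacle k : R -> R^o).
Proof.
rewrite /obstacle /corner; case: (k == 0); last first.
  by apply: (@lipschitz_abs_continuous _ _ _ _ 0) => u v *; rewrite subrr normr0 mul0r.
apply: abs_continuous_le hi _ => u v u0 uv vT; exists u, v; split => //.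
by rewrite /c !clamp_id// in_itv/=; apply/andP; split; lra.
Qed.

Lemma obstacle0_le k : obstacle k 0 <= x0 k 0.
Proof.
have /quadrantP x0q := hx0.
have c0 : c 0 = 0 by rewrite /c clamp_id// in_itv/= lexx ltW.
by rewrite /obstacle c0.
Qed.

Lemma circuit_drift (y : R -> 'cV[R]_2) t k : t \in `[0, T] ->
  (forall j, continuous (fun s => y (c s) j 0)) ->
  (A1 *m y t + col_integral `[0, t]%classic (fun s =>
     A2 t *m y s + col2 (1 / (L1 * C1 t) * i s) 0)) k 0 =
  drift (fun j s => y (c s) j 0) k t.
Proof.
move=> tT cy; have ct : c t = t by exact: clamp_id.
rewrite /drift /volterra /source -/c /= ct.
rewrite big_split/= !mxE -addrA; congr (_ + _).
(* The coefficient of i in row k; the value 0 lets the second row be treated like the first. *)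
pose d := if k == 0 then 1 / (L1 * C1 t) else 0.
have -> : \int[lebesgue_measure]_(s in `[0, t])
    (A2 t *m y s + col2 (1 / (L1 * C1 t) * i s) 0) k 0 =
  primitive (fun s => \sum_j A2 t k j * y (c s) j 0 + d * (i \o c) s) t.
  apply: eq_Rintegral => s; rewrite inE/= => st.
  have sT : s \in `[0, T].
    move: st tT; rewrite !in_itv/= => /andP[s0 st] /andP[_ tT].
    by rewrite s0 (le_trans st).
  have cs : c s = s by exact: clamp_id.
  rewrite !mxE /= cs; congr (_ + _).
  by rewrite /d; case: (k == 0); rewrite ?mul0r.
rewrite primitiveD; [|by apply: continuous_sum_fun => j; exact: continuousZ_fun|
  exact: continuousZ_fun].
rewrite primitive_sum// primitiveZ//; congr (_ + _).
by rewrite /d; case: (k == 0); rewrite ?mul0r.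
Qed.

Let solution := circuit_solution T R1 R2 L1 L2 i C1 C2 C3 x0.
Let reflected := reflected_solution T obstacle (fun k => x0 k 0) drift.

Let interior t : t \in `]0, T[ -> t \in `[0, T].
Proof. by rewrite !in_itv/= => /andP[/ltW -> /ltW ->]. Qed.

Let near_clamp (y : R -> 'cV[R]_2) k t : t \in `]0, T[ ->
  \forall s \near t, y s k 0 = y (c s) k 0.
Proof.
move=> tT; near=> s; congr (y _ k 0); apply/esym/clamp_id/interior.
by near: s; exact: near_in_itvoo.
Unshelve. all: by end_near. Qed.

Let clamped_coord_continuous (y : R -> 'cV[R]_2) k :
  abs_continuous 0 T y -> continuous (fun s => y (c s) k 0).
Proof.
move=> acy; have := abs_continuous_coord k acy.
exact: (abs_continuous_clamp_continuous (ltW hT)).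
Qed.

Let drift_clamp (x : 'I_2 -> R -> R) k t : t \in `[0, T] ->
  drift (fun j s => x j (c s)) k t = drift x k t.
Proof.
move=> tT; have ct : c t = t by exact: clamp_id.
rewrite /drift /volterra -/c ct; congr (_ + _); apply: eq_bigr => j _.
congr (_ + _ * _); apply: eq_Rintegral => s; rewrite inE/= => st.
rewrite /c clamp_id//; move: st tT; rewrite !in_itv/= => /andP[s0 st] /andP[_ tT].
by rewrite s0 (le_trans st).
Qed.

(** Values of y outside [0, T] are arbitrary, hence the clamp; near interior points it changes
    nothing. A normal vector is v = - y' - drift, so v <= 0 reads y' >= - drift. *)
Lemma reflected_of_circuit (y : R -> 'cV[R]_2) :
  solution y -> reflected (fun k s => y (c s) k 0).
Proof.
move=> [acy y0 dy] k; have cy k' := @clamped_coord_continuous y k' acy.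
have acyk := abs_continuous_coord k acy.
split.
- exact: cy.
- apply: abs_continuous_le acyk _ => u v u0 uv vT; exists u, v; split => //.
  by rewrite /c !clamp_id// in_itv/=; apply/andP; split; lra.
- by rewrite /c clamp_id ?y0// in_itv/= lexx ltW.
apply: filterS dy; first exact: (ae_filter_ringOfSetsType (@lebesgue_measure R)).
move=> t dyt tT; have tT' := interior tT; have ct : c t = t by exact: clamp_id.
have [dt [v /normal_cone_quadrantP vN]] := dyt tT'.
rewrite -addrA => /(congr1 (fun w : 'cV[R]_2 => w k 0)).
rewrite mxE circuit_drift// => vE.
have dyk : is_derive t 1 (fun s => y (c s) k 0) (derive1 y t k 0).
  apply: (near_eq_is_derive (near_clamp y k tT)).
  apply: (iffLR (is_derive_col y t (derive1 y t))).
  by split => //; rewrite derive1E.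
have {}vE : derive1 y t k 0 = - v k 0 - drift (fun j s => y (c s) j 0) k t.
  by move: vE; rewrite mxE; lra.
have [v1 v2 v3] := vN k.
rewrite derive1E; case: dyk => d1 ->; rewrite /obstacle ct vE; split => //.
- lra.
- by move=> /v3 ->; rewrite oppr0 sub0r.
Qed.

Lemma circuit_of_reflected (x : 'I_2 -> R -> R) :
  reflected x -> solution (fun t => \col_k x k t).
Proof.
move=> xS; have colE t k : (\col_k x k t) k 0 = x k t by rewrite mxE.
have acx : abs_continuous 0 T (fun t => \col_k x k t).
  apply: abs_continuous_col2 => k; have [_ + _ _] := xS k.
  by rewrite [in X in _ -> X](_ : (fun s => _) = x k)//; apply/funext => t; rewrite colE.
split => //.
  by apply/colP => k; rewrite colE; have [] := xS k.
have [_ _ _ dx0] := xS 0; have [_ _ _ dx1] := xS 1.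
have ae := ae_filter_ringOfSetsType (@lebesgue_measure R).
(* The reflection problem speaks of ]0, T[ and the circuit of [0, T]; the two endpoints are
   discarded as a null set. *)
have nT : {ae @lebesgue_measure R, forall t, t <> 0 /\ t <> T}.
  by apply: filterS2 (ae_neq 0) (ae_neq T) => t.
apply: filterS3 nT dx0 dx1 => t [/eqP nt0 /eqP ntT] + + tT.
have tT' : t \in `]0, T[.
  by move: tT; rewrite !in_itv/= !lt_neqAle eq_sym nt0 ntT.
move=> /(_ tT') d0 /(_ tT') d1.
have ct : c t = t by exact: clamp_id.
have dx k : [/\ derivable (x k) t 1, obstacle k t <= x k t, - drift x k t <= derive1 (x k) t &
          obstacle k t < x k t -> derive1 (x k) t = - drift x k t].
  by case: (ord2P k) => ->.
have dX : is_derive t 1 (fun t => \col_k x k t) (\col_k derive1 (x k) t).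
  apply/is_derive_col => k; rewrite mxE.
  rewrite (_ : (fun s => _) = x k); last by apply/funext => s; rewrite colE.
  by have [d _ _ _] := dx k; split; rewrite ?derive1E.
split; first by case: dX.
pose w := A1 *m (\col_k x k t) + col_integral `[0, t]%classic (fun s =>
  A2 t *m (\col_k x k s) + col2 (1 / (L1 * C1 t) * i s) 0).
(* The equation forces this normal vector; its membership in the cone is then checked by
   coordinates. *)
exists (- derive1 (fun t => \col_k x k t) t - w); last by rewrite -addrA subrK.
have cx j : continuous (fun s => (\col_k x k (c s)) j 0).
  exact: (@clamped_coord_continuous (fun t => \col_k x k t) j acx).
have wE k : w k 0 = drift x k t.
  rewrite /w circuit_drift// -[RHS]drift_clamp//; congr drift.
  by apply/funext => j; apply/funext => s; rewrite colE.
clearbody w; apply/normal_cone_quadrantP => k; have [_ e1 e2 e3] := dx k.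
rewrite !mxE wE derive1E; case: dX => _ ->; rewrite mxE.
move: e1 e3; rewrite /obstacle ct => e1 e3; split => //; first lra.
by move=> /e3 ->; rewrite opprK subrr.
Qed.

End circuit.

Theorem proposition6p1 (R : realType) (T R1 R2 L1 L2 : R) (i C1 C2 C3 : R -> R)
    (hT : 0 < T) (hR1 : 0 <= R1) (hR2 : 0 <= R2) (hL1 : 0 < L1) (hL2 : 0 < L2)
    (hi : abs_continuous 0 T (i : R -> R^o))
    (hC1 : {within `[0, T], continuous C1})
    (hC2 : {within `[0, T], continuous C2})
    (hC3 : {within `[0, T], continuous C3})
    (nzC1 : forall t, t \in `[0, T] -> C1 t != 0)
    (nzC2 : forall t, t \in `[0, T] -> C2 t != 0)
    (nzC3 : forall t, t \in `[0, T] -> C3 t != 0)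
    (x0 : 'cV[R]_2) (hx0 : quadrant (i 0) x0) :
  exists x : R -> 'cV[R]_2,
    circuit_solution T R1 R2 L1 L2 i C1 C2 C3 x0 x /\
    forall y : R -> 'cV[R]_2,
      circuit_solution T R1 R2 L1 L2 i C1 C2 C3 x0 y ->
      forall t, t \in `[0, T] -> y t = x t.
Proof.
have cA2 := continuous_A2 hT hL1 hL2 hC1 hC2 hC3 nzC1 nzC2 nzC3.
have cs := continuous_source hT hL1 hi hC1 nzC1.
have [K K0 lipF] := volterra_lipschitz T (circuit_A1 R1 R2 L1 L2) (source T L1 i C1) cA2.
have cF := @continuous_volterra _ _ _ (circuit_A1 R1 R2 L1 L2) _ _ (ltW hT) cA2 cs.
have [x xS] := reflected_exists hT K0 cF lipF (continuous_obstacle hT hi)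
  (abs_continuous_obstacle hi) (obstacle0_le hT hx0).
exists (fun t => \col_k x k t); split.
  exact: (circuit_of_reflected hT hi xS).
move=> y /(reflected_of_circuit hT hi) yS t tT.
apply/colP => k; rewrite mxE.
have tT' : 0 <= t <= T by move: tT; rewrite in_itv.
by rewrite -(reflected_unique hT K0 lipF xS yS k tT') clamp_id.
Qed.
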